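(* Let $\alpha\in(0,1)$, $a<b$, let $A\in\mathbb{R}^{d\times d}$ be a real symmetric matrix, $B\in\mathbb{R}^{d\times N}$ a real matrix, and let $g\in C([a,b];\mathbb{R})$ satisfy $g(t)\neq0$ for almost every $t\in[a,b]$. Let $y_0\in\mathbb{R}^d$. The system $$ {}_a^C\mathrm{D}_t^{\alpha}y(t)=A g(t)y(t)+Bu(t),\quad t\in[a,b],\qquad y(a)=y_0, $$ is controllable if and only if the Kalman rank condition is satisfied, i.e., $$ \mathrm{rank}\,[B\,|\,AB\,|\,A^2B\,|\cdots|\,A^{d-1}B]=d. $$
   Context: Left Riemann-Liouville integral: ${}_a\mathrm{I}_t^{\alpha}\varphi(t)=\frac{1}{\Gamma(\alpha)}\int_a^t(t-s)^{\alpha-1}\varphi(s)\,ds$. Left Caputo derivative: ${}_a^C\mathrm{D}_t^{\alpha}\varphi(t)=\frac{1}{\Gamma(1-\alpha)}\int_a^t\frac{\varphi'(s)}{(t-s)^{\alpha}}\,ds$. State-transition matrices: $\Psi(a,t)=\sum_{k\ge0}A^k\,{}_a\mathrm{J}_t^{k\circ\alpha}g(t)$ with ${}_a\mathrm{J}_t^{0\circ\alpha}g=1$ and ${}_a\mathrm{J}_t^{k\circ\alpha}g={}_a\mathrm{I}_t^{\alpha}\big(g\cdot{}_a\mathrm{J}_t^{(k-1)\circ\alpha}g\big)$ for $k\ge1$; and, for $a\le\tau<t\le b$, $\Phi(\tau,t)=\sum_{k\ge0}A^k\,{}_\tau\mathrm{I}_t^{k\circ\alpha}g(t)$ with ${}_\tau\mathrm{I}_t^{0\circ\alpha}g(t)=\frac{(t-\tau)^{\alpha-1}}{\Gamma(\alpha)}$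 and ${}_\tau\mathrm{I}_t^{k\circ\alpha}g={}_\tau\mathrm{I}_t^{\alpha}\big(g\cdot{}_\tau\mathrm{I}_t^{(k-1)\circ\alpha}g\big)$ for $k\ge1$. The solution of the system is given by $y(t)=\Psi(a,t)y_0+\int_a^t\Phi(\tau,t)Bu(\tau)\,d\tau$. The system is called controllable if for every $y_b\in\mathbb{R}^d$ there exists a control function $u:[a,b]\to\mathbb{R}^N$ such that the solution of the system satisfies $y(b)=y_b$. $[B|AB|\cdots|A^{d-1}B]$ is the $d\times dN$ block matrix obtained by juxtaposing the blocks. *)

(* Defs.v *)
From HB Require Import structures.
From mathcomp Require Import all_boot all_order all_algebra.
From mathcomp Require Import all_classical all_reals all_analysis.

Set Implicit Arguments.
Unset Strict Implicit.
Unset Printing Implicit Defensive.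

Import Order.TTheory GRing.Theory Num.Theory.
Import numFieldNormedType.Exports.

Local Open Scope classical_set_scope.
Local Open Scope ring_scope.

Definition Gamma (R : realType) (z : R) : R :=
  \int[lebesgue_measure]_(x in `]0, +oo[) (x `^ (z - 1) * expR (- x)).

(* Left Riemann-Liouville integral of order [al].  Since 0 `^ r = 0 for r != 0,
   the singular kernel takes the value 0 at s = t, a null set. *)
Definition rl_integral (R : realType) (al a : R) (phi : R -> R) (t : R) : R :=
  (Gamma al)^-1 *
  \int[lebesgue_measure]_(s in `[a, t]) ((t - s) `^ (al - 1) * phi s).

Fixpoint iterJ (R : realType) (al a : R) (g : R -> R) (k : nat) : R -> R :=
  if k is k'.+1 then rl_integral al a (fun s => g s * iterJ al a g k' s)
  else fun=> 1.

Fixpoint iterI (R : realType) (al tau : R) (g : R -> R) (k : nat) : R -> R :=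
  if k is k'.+1 then rl_integral al tau (fun s => g s * iterI al tau g k' s)
  else fun t => (t - tau) `^ (al - 1) / Gamma al.

Definition Psi (R : realType) (d : nat) (al : R) (A : 'M[R]_d) (g : R -> R)
    (a t : R) : 'M[R]_d :=
  limn (series (fun k => iterJ al a g k t *: A ^+ k)).

(* Only meaningful for tau < t; the diagonal is a null set in [solution]. *)
Definition Phi (R : realType) (d : nat) (al : R) (A : 'M[R]_d) (g : R -> R)
    (tau t : R) : 'M[R]_d :=
  limn (series (fun k => iterI al tau g k t *: A ^+ k)).

(* The controls are the measurable functions on [a, b] for which the integral
   in the solution formula below exists (entrywise, in the Lebesgue sense) at
   every time of [a, b]. *)
Definition control_function (R : realType) (d N : nat) (al a b : R)
    (A : 'M[R]_d) (B : 'M[R]_(d, N)) (g : R -> R) (u : R -> 'cV[R]_N) : Prop :=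
  (forall j : 'I_N, measurable_fun `[a, b] (fun t => u t j 0)) /\
  (forall (t : R) (i : 'I_d), t \in `[a, b] ->
     (@lebesgue_measure R).-integrable `[a, t]
       (fun tau => ((Phi al A g tau t *m B *m u tau) i 0)%:E)).

(* The solution of  (C_a D_t^al) y = g A y + B u,  y(a) = y0,  is understood in
   the mild sense, through the state-transition matrices: for g merely
   continuous, y need not have a derivative y' for which the Caputo derivative
   makes sense literally. *)
Definition solution (R : realType) (d N : nat) (al a : R)
    (A : 'M[R]_d) (B : 'M[R]_(d, N)) (g : R -> R) (y0 : 'cV[R]_d)
    (u : R -> 'cV[R]_N) (t : R) : 'cV[R]_d :=
  Psi al A g a t *m y0 +
  \col_(i < d) \int[lebesgue_measure]_(tau in `[a, t])
                 ((Phi al A g tau t *m B *m u tau) i 0).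

Definition controllable (R : realType) (d N : nat) (al a b : R)
    (A : 'M[R]_d) (B : 'M[R]_(d, N)) (g : R -> R) (y0 : 'cV[R]_d) : Prop :=
  forall yb : 'cV[R]_d, exists2 u : R -> 'cV[R]_N,
    control_function al a b A B g u & solution al a A B g y0 u b = yb.

Definition kalman_matrix (R : realType) (d N : nat)
    (A : 'M[R]_d) (B : 'M[R]_(d, N)) : 'M[R]_(d, \sum_(k < d) N) :=
  \mxrow_(k < d) (A ^+ k *m B).

(* Main.v *)
Require Import Defs.
From HB Require Import structures.
From mathcomp Require Import all_boot all_order all_algebra.
From mathcomp Require Import all_classical all_reals all_analysis.
From mathcomp Require Import measurable_realfun ring lra.

(* The row vectors v with v A^k B = 0 for all k annihilate Phi(x, b) B, hence
   every reachable displacement; this gives necessity.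

   Conversely put F_j(x) = v A^j Phi(x, b) B.  Unfolding the iterated integrals
   from the left end gives the dual Volterra equation
     F_j(x) = v A^j B (b - x)^(al-1) / Gamma(al) + I(g F_(j+1))(x),
   where I is the right-sided Riemann-Liouville integral.  Convolving with
   x^(-al) (Abel inversion) shows that F_j = 0 a.e. forces v A^j B = 0 and
   g F_(j+1) = 0 a.e., and so F_(j+1) = 0 a.e., as g <> 0 a.e.  Hence F_0 = 0
   a.e. implies v A^k B = 0 for all k, which makes the (weighted) Gramian
   invertible under the Kalman condition, and the Gramian yields the control.

   The series converge because the kernel x^(al-1), once weighted by exp(-c x),
   has an arbitrarily small integral for c large. *)

Set Implicit Arguments.
Unset Strict Implicit.
Unset Printing Implicit Defensive.

Import Order.TTheory GRing.Theory Num.Theory.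
Import numFieldNormedType.Exports.

Local Open Scope classical_set_scope.
Local Open Scope ring_scope.

(** * Affine substitutions in the Lebesgue integral *)

(** A product of two entries of [Phi al A g x b *m B] can grow like (b - x)^(2al - 2), which is not
    integrable near b when al <= 1/2. The unweighted Gramian may then diverge and its control may be
    inadmissible. The factor (b - x)^(1 - al) removes one of the two singularities and is positive
    for x < b, so it does not affect nondegeneracy. The same singularity rules out sup-norm
    estimates of the iterated integrals. The bounds are carried by the singular kernel itself times
    an exponential: e^(c(t-x)) (t-x)^(al-1) is reproduced by one more fractional integration up to a
    factor that is small for c large. The iterates thus decay at any prescribed geometric rate,
    which beats the growth of A^k. Matrices enter only through scalar coefficients c k = (P A^k
    Q)_ij. The analysis is done for scalar series, and passing from F_j to F_(j+1) is a shift of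
    c. *)

Section affine_substitution.
Context {R : realType}.
Notation mu := (@lebesgue_measure R).
Local Open Scope ereal_scope.

(** The image of Lebesgue measure under x |-> c x + d, multiplied by c, agrees with Lebesgue measure
    on half-open intervals, hence everywhere by uniqueness. *)
Lemma ge0_integral_affine (c d : R) (f : R -> \bar R) : (0 < c)%R ->
  measurable_fun setT f -> (forall x, 0 <= f x) ->
  \int[mu]_x f (c * x + d)%R = c^-1%:E * \int[mu]_x f x.
Proof.
move=> c0 mf f0.
have mphi : measurable_fun setT ((fun x => c * x + d)%R : R -> measurableTypeR R).
  by apply: measurable_funD => //; apply: measurable_funM.
have cnn : (0 <= c)%R := ltW c0.
pose nu := mscale (NngNum cnn)
  (measure_function_pushforward__canonical__measure_function_Measure mu mphi).
have munu A : measurable A -> mu A = nu A.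
  apply: lebesgue_measure_unique => _ [[x y]] _ <- /=.
  rewrite /nu /mscale/= /pushforward.
  have -> : (fun x : R => c * x + d)%R @^-1` `]x, y] =
            `]((x - d) / c)%R, ((y - d) / c)%R]%classic.
    apply/seteqP; split => z /=; rewrite !in_itv/= ltr_pdivrMr// ler_pdivlMr//;
    by rewrite ltrBlDr lerBrDr [(z * c)%R]mulrC.
  rewrite !lebesgue_measure_itv/= !lte_fin ltr_pM2r ?invr_gt0//.
  rewrite ltrD2r; case: ifP => _; last by rewrite mule0.
  rewrite -!EFinB -EFinM; congr (_%:E).
  by field; rewrite gt_eqF.
have -> : \int[mu]_x f x = \int[nu]_x f x.
  by apply: eq_measure_integral => A mA _; exact: munu.
rewrite ge0_integral_mscale//= ge0_integral_pushforward// muleA -EFinM mulVf ?gt_eqF//.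
by rewrite mul1e preimage_setT.
Qed.

Lemma ge0_integral_reflect (t : R) (f : R -> \bar R) :
  measurable_fun setT f -> (forall x, 0 <= f x) ->
  \int[mu]_x f (t - x)%R = \int[mu]_x f x.
Proof.
move=> mf f0.
have mg : measurable_fun setT (fun x : R => f (1 * x + t)%R).
  by apply: measurableT_comp => //; exact: measurable_funD.
rewrite -[RHS]mul1e -(invr1 R) -(@ge0_integral_affine 1 t)//.
transitivity (\int[pushforward mu (-%R : R -> measurableTypeR R)]_x f (1 * x + t)%R).
  rewrite ge0_integral_pushforward//= preimage_setT; apply: eq_integral => x _ /=.
  by rewrite mul1r addrC.
by apply: eq_measure_integral => A mA _; apply: lebesgue_measureN.
Qed.

Lemma ge0_integral_translate (t : R) (f : R -> \bar R) :
  measurable_fun setT f -> (forall x, 0 <= f x) ->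
  \int[mu]_x f (x - t)%R = \int[mu]_x f x.
Proof.
move=> mf f0; rewrite -[RHS]mul1e -(invr1 R) -(@ge0_integral_affine 1 (- t))//.
by apply: eq_integral => x _; rewrite mul1r.
Qed.

End affine_substitution.

(** * The kernel of Riemann-Liouville integration *)

Section abel_kernel.
Context {R : realType}.
Notation mu := (@lebesgue_measure R).
Implicit Types r x y c : R.

(* The test is needed because x `^ s = 1 for x < 0. *)
Definition abelk r x := if 0 < x then x `^ (r - 1) else 0.

Lemma abelk_gt0E r x : 0 < x -> abelk r x = x `^ (r - 1).
Proof. by rewrite /abelk => ->. Qed.

Lemma abelk_le0E r x : x <= 0 -> abelk r x = 0.
Proof. by rewrite /abelk ltNge => ->. Qed.

Lemma abelk_ge0 r x : 0 <= abelk r x.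
Proof. by rewrite /abelk; case: ifP => // _; exact: powR_ge0. Qed.

Lemma measurable_abelk r : measurable_fun setT (abelk r).
Proof.
by apply: measurable_fun_ifT => //; exact: measurable_fun_ltr.
Qed.

Lemma abelkZ r c x : 0 < c -> abelk r (c * x) = c `^ (r - 1) * abelk r x.
Proof.
move=> c0; rewrite /abelk pmulr_rgt0//; case: ifPn => x0; last by rewrite mulr0.
by rewrite powRM// ltW.
Qed.

Lemma abelk_anti r x y : r < 1 -> 0 < x -> x <= y -> abelk r y <= abelk r x.
Proof.
move=> r1 x0 xy; have y0 := lt_le_trans x0 xy.
rewrite !abelk_gt0E// -[r - 1]opprB !powRN lef_pV2 ?posrE ?powR_gt0//.
by apply: ge0_ler_powR => //; rewrite ?nnegrE ?subr_ge0 ltW.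
Qed.

(** On [1/(n+1), 1] the primitive x^r / r is smooth and bounds the integral by 1/r uniformly in n;
    monotone convergence then reaches the singular endpoint 0. *)
Lemma integral_abelk01 r : 0 < r ->
  (\int[mu]_(x in `]0%R, 1%R]) (abelk r x)%:E < +oo)%E.
Proof.
move=> r0.
pose F (n : nat) : set R := `[n.+1%:R^-1, 1]%classic.
have FU : \bigcup_n F n = `]0, 1]%classic.
  apply/seteqP; split => [x [n _]|x]; rewrite /F/= !in_itv/=.
    by case/andP=> nx ->; rewrite (lt_le_trans _ nx)// invr_gt0.
  case/andP=> x0 x1; exists (Num.truncn x^-1) => //; rewrite /= in_itv/= x1 andbT.
  rewrite -[x in _ <= x]invrK lef_pV2 ?posrE ?invr_gt0//.
  by rewrite ltW// truncnS_gt.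
have intF n : (\int[mu]_(x in F n) (abelk r x)%:E <= (r^-1)%:E)%E.
  have n1 : n.+1%:R^-1 <= 1 :> R by rewrite invf_le1 ?ler1n.
  have n0 : 0 < n.+1%:R^-1 :> R by rewrite invr_gt0.
  (* [F 0] is the single point 1, while the fundamental theorem of calculus asks for a nondegenerate
     interval. *)
  move: n1; rewrite le_eqVlt => /orP[/eqP n1|n1].
    by rewrite /F n1 set_itv1 integral_set1 lee_fin invr_ge0 ltW.
  have Fpos x : x \in F n -> 0 < x.
    by rewrite inE /F/= in_itv/= => /andP[nx _]; exact: lt_le_trans nx.
  have -> : (\int[mu]_(x in F n) (abelk r x)%:E =
            \int[mu]_(x in F n) (x `^ (r - 1))%:E)%E.
    by apply: eq_integral => x /Fpos x0; rewrite abelk_gt0E.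
  have dF x : 0 < x -> is_derive x 1 (fun x => r^-1 * x `^ r) (x `^ (r - 1)).
    move=> x0; have h := is_derive1_powR r x0.
    by apply: is_derive_eq; rewrite /= /GRing.scale/= mulKf ?gt_eqF.
  rewrite /F (@continuous_FTC2 _ _ (fun x => r^-1 * x `^ r))//.
  - rewrite powR1 mulr1 -EFinB lee_fin lerBlDr lerDl.
    by rewrite mulr_ge0 ?powR_ge0// invr_ge0 ltW.
  - apply: continuous_in_subspaceT => x /Fpos x0.
    apply: differentiable_continuous; apply/derivable1_diffP.
    by have [] := is_derive1_powR (r - 1) x0.
  - have cF x : 0 < x -> {for x, continuous (fun x => r^-1 * x `^ r)}.
      move=> x0; apply: differentiable_continuous; apply/derivable1_diffP.
      by have [] := dF _ x0.
    split.
    + move=> x; rewrite in_itv/= => /andP[nx _].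
      by have [] := dF _ (lt_trans n0 nx).
    + exact: (cvg_at_right_filter (cF _ n0)).
    + exact: (cvg_at_left_filter (cF _ ltr01)).
  - move=> x; rewrite in_itv/= => /andP[nx _]; rewrite derive1E.
    by have [] := dF _ (lt_trans n0 nx).
have ndF : {homo F : m n / (m <= n)%N >-> (m <= n)%O}.
  move=> m n mn; apply/subsetPset => x; rewrite /F/= !in_itv/= => /andP[mx ->].
  by rewrite andbT (le_trans _ mx)// lef_pV2 ?posrE ?ler_nat.
apply: (@le_lt_trans _ _ (r^-1)%:E); last exact: ltry.
have := @ge0_nondecreasing_set_cvg_integral _ (measurableTypeR R) R F
  (EFin \o abelk r) mu ndF.
rewrite FU => /(_ _ _ _)/cvg_lim <- //.
- apply: lime_le; last by apply: nearW => n; exact: intF.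
  apply: ereal_nondecreasing_is_cvgn => m n mn.
  apply: ge0_subset_integral.
  - exact: measurable_itv.
  - exact: measurable_itv.
  - by apply/measurable_EFinP; apply: measurable_funTS; exact: measurable_abelk.
  - by move=> x _; rewrite lee_fin abelk_ge0.
  - by apply/subsetPset/ndF.
- by move=> n; exact: measurable_itv.
- by move=> n; apply/measurable_EFinP; apply: measurable_funTS; exact: measurable_abelk.
- by move=> n x _; rewrite lee_fin abelk_ge0.
Qed.

End abel_kernel.

Section real_ge0_integrals.
Context d (T : measurableType d) {R : realType} (m : {measure set T -> \bar R}).
Implicit Types f g : T -> R.
Local Open Scope ereal_scope.

Lemma measurable_EFin_fun (D : set T) f :
  measurable_fun D f -> measurable_fun D (fun x => (f x)%:E).
Proof. by move=> mf; apply/measurable_EFinP. Qed.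

Lemma ge0_le_integral_EFin f g :
  measurable_fun setT f -> measurable_fun setT g ->
  (forall x, 0 <= f x)%R -> (forall x, f x <= g x)%R ->
  \int[m]_x (f x)%:E <= \int[m]_x (g x)%:E.
Proof.
move=> mf mg f0 fg; apply: ge0_le_integral => //.
- by move=> x _; rewrite lee_fin.
- exact/measurable_EFinP.
- exact/measurable_EFinP.
- by move=> x _; rewrite lee_fin.
Qed.

Lemma ge0_integralD_EFin f g :
  measurable_fun setT f -> measurable_fun setT g ->
  (forall x, 0 <= f x)%R -> (forall x, 0 <= g x)%R ->
  \int[m]_x (f x + g x)%:E = \int[m]_x (f x)%:E + \int[m]_x (g x)%:E.
Proof.
move=> mf mg f0 g0; rewrite -ge0_integralD//.
- by move=> x _; rewrite lee_fin.
- exact/measurable_EFinP.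
- by move=> x _; rewrite lee_fin.
- exact/measurable_EFinP.
Qed.

Lemma ge0_integralZl_real f (c : R) :
  measurable_fun setT f -> (0 <= c)%R -> (forall x, 0 <= f x)%R ->
  \int[m]_x (c * f x)%:E = c%:E * \int[m]_x (f x)%:E.
Proof.
move=> mf c0 f0; under eq_integral do rewrite EFinM.
rewrite ge0_integralZl_EFin//; first by move=> x _; rewrite lee_fin.
exact/measurable_EFinP.
Qed.

Lemma dominated_integrable f g :
  measurable_fun setT f -> measurable_fun setT g ->
  (forall x, `|f x| <= g x)%R -> \int[m]_x (g x)%:E < +oo ->
  m.-integrable setT (EFin \o f).
Proof.
move=> mf mg fg goo; apply/integrableP; split; first exact/measurable_EFinP.
apply: le_lt_trans goo; apply: ge0_le_integral_EFin => //.
exact: measurableT_comp.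
Qed.

End real_ge0_integrals.

(** * The Gamma function and the Laplace transform of the kernel *)

Section abel_kernel_integrals.
Context {R : realType}.
Notation mu := (@lebesgue_measure R).
Variable r : R.
Hypotheses (r0 : 0 < r) (r1 : r < 1).

(** Extended-valued form of [Gamma r], so that nonnegative integrals can be handled before
    finiteness is known. *)
Definition gammaE : \bar R := (\int[mu]_x (abelk r x * expR (- x))%:E)%E.

Lemma measurable_abelk_expR (c : R) :
  measurable_fun setT (fun x => abelk r x * expR (c * x)).
Proof.
apply: measurable_funM; first exact: measurable_abelk.
by apply: measurableT_comp => //; apply: measurable_funM.
Qed.

(** On (0, 1] the exponential is at most 1 and the kernel is integrable; beyond 1 the kernel is at
    most 1 and the exponential probability density dominates. *)
Lemma gammaE_lty : (gammaE < +oo)%E.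
Proof.
have mA : measurable_fun setT (abelk r \_ `]0, 1]).
  by apply/measurable_restrict => //; apply: measurable_funTS; exact: measurable_abelk.
have mE : measurable_fun setT (@exponential_pdf R 1).
  exact: measurable_exponential_pdf.
have A0 x : 0 <= (abelk r \_ `]0, 1]) x.
  by apply: restrict_ge0 => y _; exact: abelk_ge0.
have E0 x : 0 <= @exponential_pdf R 1 x by exact: exponential_pdf_ge0.
apply: (@le_lt_trans _ _
  (\int[mu]_x ((abelk r \_ `]0%R, 1%R]) x + exponential_pdf 1 x)%:E)%E).
  apply: ge0_le_integral_EFin.
  - by under eq_fun do rewrite -mulN1r; exact: measurable_abelk_expR.
  - exact: measurable_funD.
  - by move=> x; rewrite mulr_ge0 ?abelk_ge0 ?expR_ge0.
  - move=> x; have [x0|x0] := leP x 0.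
      by rewrite abelk_le0E// mul0r addr_ge0.
    rewrite (exponential_pdfE _ (ltW x0)) mul1r mulN1r.
    have [x1|x1] := leP x 1.
      rewrite patchE mem_set/= ?in_itv/= ?x0//.
      rewrite -[leLHS]addr0 lerD ?expR_ge0// ler_piMr ?abelk_ge0//.
      by rewrite -expR0 ler_expR lerNl oppr0 ltW.
    rewrite -[leLHS]add0r lerD// ler_piMl ?expR_ge0//.
    apply: (le_trans (abelk_anti r1 ltr01 (ltW x1))).
    by rewrite abelk_gt0E// powR1.
rewrite ge0_integralD_EFin// (integral_exponential_pdf ltr01) lte_add_pinfty ?ltry//.
have := integral_abelk01 r0; rewrite [X in (X < _)%E -> _]integral_mkcond.
by under eq_integral do rewrite restrict_EFin.
Qed.

Lemma gammaE_gt0 : (0 < gammaE)%E.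
Proof.
apply: (@lt_le_trans _ _ (expR (- 1))%:E); first by rewrite lte_fin expR_gt0.
apply: (@le_trans _ _ (\int[mu]_x (expR (- 1) * \1_(`]0%R, 1%R]) x)%:E)%E).
  rewrite ge0_integralZl_real ?expR_ge0//.
  rewrite integral_indic// setIT [X in (_ <= _ * X)%E](_ : _ = 1%E) ?mule1//.
  by rewrite [LHS]lebesgue_measure_itv/= lte_fin ltr01 oppr0 adde0.
apply: ge0_le_integral_EFin.
- exact: measurable_funM.
- by under eq_fun do rewrite -mulN1r; exact: measurable_abelk_expR.
- by move=> x; rewrite mulr_ge0 ?expR_ge0.
- move=> x; rewrite indicE; case: (boolP (x \in _)) => [|_]; last first.
    by rewrite mulr0 mulr_ge0 ?abelk_ge0 ?expR_ge0.
  rewrite inE/= in_itv/= => /andP[x0 x1].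
  rewrite mulr1 -[leLHS]mul1r ler_pM ?expR_ge0//; last first.
    by rewrite ler_expR lerN2.
  by apply: le_trans (abelk_anti r1 x0 x1); rewrite abelk_gt0E// powR1.
Qed.

Lemma gammaE_fin : gammaE \is a fin_num.
Proof. by rewrite ge0_fin_numE ?gammaE_lty// ltW// gammaE_gt0. Qed.

Lemma Gamma_gammaE : (Gamma r)%:E = gammaE.
Proof.
suff -> : Gamma r = fine gammaE by rewrite fineK// gammaE_fin.
rewrite /Gamma /gammaE /Rintegral integral_mkcond/=; congr fine.
apply: eq_integral => x _; rewrite patchE; case: ifPn.
  by rewrite inE/= in_itv/= andbT => x0; rewrite abelk_gt0E.
rewrite notin_setE/= in_itv/= andbT => /negP; rewrite -leNgt => x0.
by rewrite abelk_le0E// mul0r.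
Qed.

Lemma Gamma_gt0 : 0 < Gamma r.
Proof. by rewrite -lte_fin Gamma_gammaE gammaE_gt0. Qed.

Lemma integral_abelk_expR (c : R) : 0 < c ->
  (\int[mu]_x (abelk r x * expR (- c * x))%:E = (c `^ (- r) * Gamma r)%:E)%E.
Proof.
move=> c0.
have := @ge0_integral_affine R c 0 (fun x => (abelk r x * expR (- x))%:E) c0.
rewrite -/gammaE -Gamma_gammaE -EFinM => h.
have -> : c `^ (- r) * Gamma r = c `^ (1 - r) * (c^-1 * Gamma r).
  rewrite mulrA -powR_inv1 ?ltW// -powRD ?(gt_eqF c0) ?implybT//.
  by congr (_ `^ _ * _); ring.
rewrite EFinM -h; first last.
- by move=> x; rewrite lee_fin mulr_ge0 ?abelk_ge0 ?expR_ge0.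
- apply/measurable_EFinP; under eq_fun do rewrite -mulN1r.
  exact: measurable_abelk_expR.
rewrite -ge0_integralZl_real ?powR_ge0//; first last.
- by move=> x; rewrite mulr_ge0 ?abelk_ge0 ?expR_ge0.
- under eq_fun do rewrite addr0 abelkZ// -mulNr -mulrA.
  by apply: measurable_funM => //; exact: measurable_abelk_expR.
apply: eq_integral => x _; rewrite addr0 abelkZ// !mulrA mulNr.
rewrite -powRD ?(gt_eqF c0) ?implybT//.
by rewrite (_ : 1 - r + (r - 1) = 0) ?powRr0 ?mul1r//; ring.
Qed.

Lemma integral_abelk_expR_small (e : R) : 0 < e ->
  exists2 c : R, 0 < c & (\int[mu]_x (abelk r x * expR (- c * x))%:E <= e%:E)%E.
Proof.
move=> e0; have g0 := Gamma_gt0.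
(* This c solves c^(-r) Gamma(r) = e, so the bound is attained. *)
exists ((Gamma r / e) `^ r^-1); first by rewrite powR_gt0// divr_gt0.
rewrite integral_abelk_expR ?powR_gt0 ?divr_gt0// lee_fin -powRrM mulrN mulVf ?gt_eqF//.
rewrite powR_inv1 ?divr_ge0 ?(ltW g0) ?(ltW e0)// invf_div.
by rewrite mulfVK ?gt_eqF.
Qed.

End abel_kernel_integrals.

(** * Convolutions of two kernels *)

Section abel_convolution.
Context {R : realType}.
Notation mu := (@lebesgue_measure R).
Implicit Types r s c t x y : R.

Lemma measurable_abelk_sub r x : measurable_fun setT (fun t => abelk r (t - x)).
Proof.
apply: measurableT_comp; first exact: measurable_abelk.
exact: measurable_funB.
Qed.

Lemma measurable_abelk_rsub r x : measurable_fun setT (fun t => abelk r (x - t)).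
Proof.
apply: measurableT_comp; first exact: measurable_abelk.
exact: measurable_funB.
Qed.

(* The smaller of x, y carries the singularity and the larger one is at least
   (x + y) / 2; the exponential weight can be moved to either of them. *)
Lemma abelk_mul_le r c x y : r < 1 -> 0 <= c ->
  expR (- c * x) * (abelk r x * abelk r y) <=
  2^-1 `^ (r - 1) * abelk r (x + y) *
    (abelk r x * expR (- c * x) + abelk r y * expR (- c * y)).
Proof.
move=> r1 c0; rewrite -abelkZ; last by rewrite invr_gt0.
have k0 := @abelk_ge0 R r.
have [x0|x0] := leP x 0.
  rewrite (abelk_le0E _ x0) !(mul0r, mulr0, add0r).
  by rewrite mulr_ge0 ?k0// mulr_ge0 ?k0 ?expR_ge0.
have [y0|y0] := leP y 0.
  rewrite (abelk_le0E _ y0) !(mul0r, mulr0, addr0).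
  by rewrite mulr_ge0 ?k0// mulr_ge0 ?k0 ?expR_ge0.
have m0 : 0 < 2^-1 * (x + y) by rewrite mulr_gt0 ?invr_gt0 ?addr_gt0.
have [xy|/ltW yx] := leP x y.
  have my : 2^-1 * (x + y) <= y by lra.
  have kmy := abelk_anti r1 m0 my.
  rewrite mulrDr -[leLHS]addr0 lerD//; last by rewrite mulr_ge0 ?mulr_ge0 ?expR_ge0.
  have -> : expR (- c * x) * (abelk r x * abelk r y) =
            abelk r y * (abelk r x * expR (- c * x)) by ring.
  by rewrite ler_wpM2r ?mulr_ge0 ?expR_ge0.
have mx : 2^-1 * (x + y) <= x by lra.
have kmx := abelk_anti r1 m0 mx.
rewrite mulrDr -[leLHS]add0r lerD//; first by rewrite mulr_ge0 ?mulr_ge0 ?expR_ge0.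
have exy : expR (- c * x) <= expR (- c * y) by rewrite ler_expR !mulNr lerN2 ler_wpM2l.
rewrite mulrCA mulrA -mulrA ler_pM ?mulr_ge0 ?expR_ge0//.
by rewrite mulrC ler_wpM2l.
Qed.

(** The bound of [abelk_mul_le] for the two pieces y - t and t - x. Their sum y - x does not depend
    on t, so the kernel of y - x factors out and the remaining integral over t is a constant, small
    for c large. The sum is symmetric in the two pieces, so one majorant serves both placements of
    the exponential. *)
Definition conv_majorant r c x y t : R :=
  2^-1 `^ (r - 1) * abelk r (y - x) *
    (abelk r (y - t) * expR (- c * (y - t)) +
     abelk r (t - x) * expR (- c * (t - x))).

Lemma measurable_conv_majorant r c x y : measurable_fun setT (conv_majorant r c x y).
Proof.
apply: measurable_funM => //; apply: measurable_funD.
  apply: (measurableT_comp (measurable_abelk_expR r (- c))).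
  exact: measurable_funB.
apply: (measurableT_comp (measurable_abelk_expR r (- c))).
exact: measurable_funB.
Qed.

Lemma conv_majorant_ge0 r c x y t : 0 <= conv_majorant r c x y t.
Proof. by rewrite mulr_ge0 ?addr_ge0 ?mulr_ge0 ?powR_ge0 ?abelk_ge0 ?expR_ge0. Qed.

Lemma abelk_mul_le_left r c x y t : r < 1 -> 0 <= c ->
  expR (- c * (y - t)) * (abelk r (y - t) * abelk r (t - x)) <=
  conv_majorant r c x y t.
Proof.
move=> r1 c0; have := abelk_mul_le (y - t) (t - x) r1 c0.
by rewrite (_ : y - t + (t - x) = y - x); last ring.
Qed.

Lemma abelk_mul_le_right r c x y t : r < 1 -> 0 <= c ->
  expR (- c * (t - x)) * (abelk r (y - t) * abelk r (t - x)) <=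
  conv_majorant r c x y t.
Proof.
move=> r1 c0; have := abelk_mul_le (t - x) (y - t) r1 c0.
rewrite (_ : t - x + (y - t) = y - x); last by ring.
rewrite /conv_majorant [abelk r (t - x) * abelk _ _]mulrC.
by rewrite [_ * expR (- c * (t - x)) + _]addrC.
Qed.

Lemma integral_conv_majorant r c x y : 0 < r -> r < 1 -> 0 < c ->
  (\int[mu]_t (conv_majorant r c x y t)%:E =
   (2 * 2^-1 `^ (r - 1) * abelk r (y - x) * (c `^ (- r) * Gamma r))%:E)%E.
Proof.
move=> r0 r1 c0; have kE := measurable_abelk_expR r (- c).
have kE0 t : 0 <= abelk r t * expR (- c * t) by rewrite mulr_ge0 ?abelk_ge0 ?expR_ge0.
have mB (F : R -> R) : measurable_fun setT F ->
    measurable_fun setT (fun t => abelk r (F t) * expR (- c * F t)).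
  by move=> mF; exact: (measurableT_comp kE).
rewrite ge0_integralZl_real ?mulr_ge0 ?powR_ge0 ?abelk_ge0//; last 2 first.
- by apply: measurable_funD; apply: mB; exact: measurable_funB.
- by move=> t; rewrite addr_ge0.
rewrite ge0_integralD_EFin//; last 2 first.
- by apply: mB; exact: measurable_funB.
- by apply: mB; exact: measurable_funB.
rewrite (@ge0_integral_reflect _ y (fun t => (abelk r t * expR (- c * t))%:E))//;
  last exact/measurable_EFinP.
rewrite (@ge0_integral_translate _ x (fun t => (abelk r t * expR (- c * t))%:E))//;
  last exact/measurable_EFinP.
by rewrite integral_abelk_expR// -EFinD -EFinM; congr (_%:E); ring.
Qed.

(** The Beta function at (1 - r, r). Only its finiteness and positivity matter, not its value. *)
Definition abel_beta r : \bar R :=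
  (\int[mu]_t (abelk (1 - r) t * abelk r (1 - t))%:E)%E.

(** The interval is cut at 1/2: on each half one kernel is at most its value at 1/2, and the other
    has an integrable singularity at the end of that half. *)
Lemma abel_beta_lty r : 0 < r -> r < 1 -> (abel_beta r < +oo)%E.
Proof.
move=> r0 r1; set s := 1 - r.
have s0 : 0 < s by rewrite subr_gt0.
have s1 : s < 1 by rewrite ltrBlDr ltrDl.
pose K (q : R) : R -> R := abelk q \_ `]0, 1].
have mK q : measurable_fun setT (K q).
  by apply/measurable_restrict => //; apply: measurable_funTS; exact: measurable_abelk.
have K0 q t : 0 <= K q t by apply: restrict_ge0 => u _; exact: abelk_ge0.
have Koo q : 0 < q -> (\int[mu]_t (K q t)%:E < +oo)%E.
  move=> q0; have := integral_abelk01 q0.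
  rewrite [X in (X < _)%E -> _]integral_mkcond.
  by under eq_integral do rewrite restrict_EFin.
have mKr q : measurable_fun setT (fun t => K q (1 - t)).
  by apply: (measurableT_comp (mK q)); exact: measurable_funB.
apply: (@le_lt_trans _ _
  (\int[mu]_t (abelk r 2^-1 * K s t + abelk s 2^-1 * K r (1 - t))%:E)%E).
  apply: ge0_le_integral_EFin.
  - apply: measurable_funM; first exact: measurable_abelk.
    exact: measurable_abelk_rsub.
  - apply: measurable_funD; apply: measurable_funM => //.
      exact: mK.
    exact: mKr.
  - by move=> t; rewrite mulr_ge0 ?abelk_ge0.
  - move=> t; have [t0|t0] := leP t 0.
      by rewrite abelk_le0E// mul0r addr_ge0 ?mulr_ge0 ?abelk_ge0.
    have [t1|t1] := leP 1 t.
      rewrite [abelk r (1 - t)]abelk_le0E ?subr_le0// mulr0.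
      by rewrite addr_ge0 ?mulr_ge0 ?abelk_ge0.
    rewrite /K !patchE !mem_set/= ?in_itv/=; [|lra|lra].
    have h0 : 0 < 2^-1 :> R by rewrite invr_gt0.
    have [th|th] := leP t 2^-1.
      rewrite -[leLHS]addr0 lerD ?mulr_ge0 ?abelk_ge0// mulrC ler_wpM2r ?abelk_ge0//.
      by apply: abelk_anti => //; lra.
    rewrite -[leLHS]add0r lerD ?mulr_ge0 ?abelk_ge0// ler_wpM2r ?abelk_ge0//.
    by apply: abelk_anti => //; lra.
rewrite ge0_integralD_EFin//; first last.
- by move=> t; rewrite mulr_ge0 ?abelk_ge0.
- by move=> t; rewrite mulr_ge0 ?abelk_ge0.
- by apply: measurable_funM => //; exact: mKr.
- by apply: measurable_funM => //; exact: mK.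
rewrite !ge0_integralZl_real ?abelk_ge0//; [|exact: mKr|exact: mK].
rewrite (@ge0_integral_reflect _ 1 (fun t => (K r t)%:E));
  [|exact: measurable_EFin_fun|by move=> t; rewrite lee_fin].
by rewrite lte_add_pinfty// lte_mul_pinfty ?lee_fin ?abelk_ge0 ?Koo.
Qed.

Lemma abel_beta_gt0 r : 0 < r -> r < 1 -> (0 < abel_beta r)%E.
Proof.
move=> r0 r1; set s := 1 - r.
have s1 : s < 1 by rewrite ltrBlDr ltrDl.
apply: (@lt_le_trans _ _ 1%E) => //.
apply: (@le_trans _ _ (\int[mu]_t (\1_(`]0%R, 1%R[) t)%:E)%E).
  rewrite integral_indic// setIT [X in (_ <= X)%E](_ : _ = 1%E)//.
  by rewrite [LHS]lebesgue_measure_itv/= lte_fin ltr01 oppr0 adde0.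
apply: ge0_le_integral_EFin.
- by [].
- apply: measurable_funM; first exact: measurable_abelk.
  exact: measurable_abelk_rsub.
- by [].
- move=> t; rewrite indicE; case: (boolP (t \in _)) => [|_]; last first.
    by rewrite mulr_ge0 ?abelk_ge0.
  rewrite inE/= in_itv/= => /andP[t0 t1].
  have k1 (q u : R) : q < 1 -> 0 < u -> u < 1 -> 1 <= abelk q u.
    move=> q1 u0 u1; have <- : abelk q 1 = 1 by rewrite abelk_gt0E// powR1.
    by apply: abelk_anti => //; exact: ltW.
  by rewrite -[leLHS]mul1r ler_pM ?k1 ?subr_gt0// ltrBlDr ltrDl.
Qed.

(** After the substitution t -> (y - x) t + x, the powers of y - x contributed by the measure and
    the two kernels have exponents 1, -r and r - 1, which add up to 0. *)
Lemma abelk_beta_conv r x y : 0 < r -> r < 1 -> x < y ->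
  (\int[mu]_t (abelk (1 - r) (t - x) * abelk r (y - t))%:E = abel_beta r)%E.
Proof.
move=> r0 r1 xy; have d0 : 0 < y - x by rewrite subr_gt0.
have mF : measurable_fun setT (fun t => abelk (1 - r) (t - x) * abelk r (y - t)).
  apply: measurable_funM; first exact: measurable_abelk_sub.
  exact: measurable_abelk_rsub.
have F0 t : 0 <= abelk (1 - r) (t - x) * abelk r (y - t) by rewrite mulr_ge0 ?abelk_ge0.
have h := @ge0_integral_affine R (y - x) x _ d0 (measurable_EFin_fun mF)
  (fun t => F0 t).
have -> : (\int[mu]_t (abelk (1 - r) (t - x) * abelk r (y - t))%:E =
    (y - x)%:E * ((y - x)^-1%:E *
      \int[mu]_t (abelk (1 - r) (t - x) * abelk r (y - t))%:E))%E.
  by rewrite muleA -EFinM mulfV ?gt_eqF// mul1e.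
rewrite -h.
rewrite -ge0_integralZl_real; last 3 first.
- apply: (measurableT_comp mF); exact: measurable_funD.
- exact: ltW.
- by move=> t; exact: F0.
apply: eq_integral => t _; congr (_%:E).
rewrite (_ : (y - x) * t + x - x = (y - x) * t); last by ring.
rewrite (_ : y - ((y - x) * t + x) = (y - x) * (1 - t)); last by ring.
rewrite !abelkZ// -[X in X * (_ * _)](powRr1 (ltW d0)).
rewrite [X in _ * X]mulrACA !mulrA -!powRD ?(gt_eqF d0) ?implybT//.
by rewrite (_ : 1 + (1 - r - 1) + (r - 1) = 0) ?powRr0 ?mul1r//; ring.
Qed.

End abel_convolution.

(** * Integrals depending on a parameter *)

Section Rintegral_majorant.
Context d (T : measurableType d) {R : realType} (m : {measure set T -> \bar R}).

Lemma majorant_integrable (f g : T -> R) (C : R) :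
  measurable_fun setT f -> measurable_fun setT g ->
  (forall x, `|f x| <= g x) -> (\int[m]_x (g x)%:E <= C%:E)%E ->
  m.-integrable setT (EFin \o f).
Proof.
move=> mf mg fg gC; apply: (dominated_integrable mf mg fg).
by apply: le_lt_trans gC _; exact: ltry.
Qed.

Lemma normr_Rintegral_le (f g : T -> R) (C : R) :
  measurable_fun setT f -> measurable_fun setT g ->
  (forall x, `|f x| <= g x) -> (\int[m]_x (g x)%:E <= C%:E)%E ->
  `|\int[m]_x f x| <= C.
Proof.
move=> mf mg fg gC; have intf := majorant_integrable mf mg fg gC.
have mnf : measurable_fun setT (fun x => `|f x|) by exact: measurableT_comp.
have le1 : (\int[m]_x `|f x|%:E <= C%:E)%E.
  by apply: le_trans gC; exact: ge0_le_integral_EFin.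
apply: (le_trans (le_normr_Rintegral measurableT intf)).
rewrite -lee_fin /Rintegral fineK// ge0_fin_numE.
  by apply: le_lt_trans le1 _; exact: ltry.
by apply: integral_ge0 => x _; rewrite lee_fin.
Qed.

End Rintegral_majorant.

Section Rintegral_Fubini.
Context d1 d2 (T1 : measurableType d1) (T2 : measurableType d2) {R : realType}.
Variables (m1 : {sigma_finite_measure set T1 -> \bar R}).
Variables (m2 : {sigma_finite_measure set T2 -> \bar R}).
Implicit Type f : T1 * T2 -> R.

(** The integrals of the positive and negative parts are measurable in x by Tonelli, and so is
    [fine] of their difference, including at the x where it is infinite. *)
Lemma measurable_Rintegral_param f : measurable_fun setT f ->
  measurable_fun setT (fun x => \int[m2]_y f (x, y)).
Proof.
move=> mf; rewrite /Rintegral.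
have mF : measurable_fun setT (EFin \o f) by exact/measurable_EFinP.
apply: (measurableT_comp (@fine_measurable R setT measurableT)) => //.
rewrite (_ : (fun x => _) = (fun x => fubini_F m2 (EFin \o f)^\+%E x -
                                   fubini_F m2 (EFin \o f)^\-%E x)%E).
  apply: emeasurable_funB.
    apply: measurable_fun_fubini_tonelli_F => //.
    exact: measurable_funepos.
  apply: measurable_fun_fubini_tonelli_F => //.
  exact: measurable_funeneg.
apply/funext => x; rewrite [LHS]integralE /fubini_F.
by congr (_ - _)%E; apply: eq_integral => y _; rewrite !(funeposE, funenegE).
Qed.

Lemma prod_majorant_integrable f (phi : T1 -> R) :
  measurable_fun setT f -> measurable_fun setT phi ->
  (forall x, (\int[m2]_y `|f (x, y)|%:E <= (phi x)%:E)%E) ->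
  (\int[m1]_x (phi x)%:E < +oo)%E ->
  (m1 \x m2)%E.-integrable setT (EFin \o f).
Proof.
move=> mf mphi fphi phioo.
have mF : measurable_fun setT (EFin \o f) by exact/measurable_EFinP.
apply/(integrable12ltyP _ _ mF); apply: le_lt_trans phioo.
apply: ge0_le_integral => //.
- by move=> x _; exact: integral_ge0.
- apply: (measurable_fun_fubini_tonelli_F (fun z => `|(f z)%:E|)%E) => //.
  exact: measurableT_comp.
- exact/measurable_EFinP.
- by move=> x _; exact: fphi.
Qed.

Lemma Rintegral_Fubini f : (m1 \x m2)%E.-integrable setT (EFin \o f) ->
  \int[m1]_x \int[m2]_y f (x, y) = \int[m2]_y \int[m1]_x f (x, y).
Proof.
move=> intf.
(* The inner integrals are finite only almost everywhere, so [fine] can be removed under the outer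
   integral but not pointwise. *)
have fineE d (T : measurableType d) (m : {measure set T -> \bar R}) (F : T -> \bar R) :
    measurable_fun setT F -> {ae m, forall x, F x \is a fin_num} ->
    (\int[m]_x (fine (F x))%:E = \int[m]_x F x)%E.
  move=> mF finF; apply: ae_eq_integral => //.
    by apply/measurable_EFinP; apply: measurableT_comp => //; exact: fine_measurable.
  by apply: filterS finF => x Fx _; rewrite fineK.
congr fine; rewrite (fineE _ _ _ (fubini_F m2 (EFin \o f))).
- rewrite (fineE _ _ _ (fubini_G m1 (EFin \o f))).
  + exact: (Fubini intf).
  + exact: (measurable_fubini_G intf).
  + apply: filterS (ae_integrable2 intf) => y iy.
    exact: (integrable_fin_num measurableT iy).
- exact: (measurable_fubini_F intf).
- apply: filterS (ae_integrable1 intf) => x ix.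
  exact: (integrable_fin_num measurableT ix).
Qed.

End Rintegral_Fubini.

(** * Iterated fractional integrals *)

Section peano_baker.
Context {R : realType}.
Notation mu := (@lebesgue_measure R).
Variables (r : R) (G : R -> R) (M : R).
Hypotheses (r0 : 0 < r) (r1 : r < 1).
Hypotheses (mG : measurable_fun setT G) (M0 : 0 <= M).
Hypothesis GM : forall s, `|G s| <= M.

(** The left endpoint x stays a variable because the dual equation integrates over it. No bounds of
    integration are needed: the kernel vanishes for s >= t and the iterates vanish for s <= x. *)
Fixpoint abel_iter (n : nat) (x t : R) : R :=
  if n is n'.+1 then
    \int[mu]_s (abelk r (t - s) * (G s * abel_iter n' x s))
  else abelk r (t - x).

Lemma measurable_abel_iter n :
  measurable_fun setT (fun z : R * R => abel_iter n z.1 z.2).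
Proof.
elim: n => [|n IHn] /=.
  apply: (measurableT_comp (measurable_abelk r)).
  exact: measurable_funB.
apply: (@measurable_Rintegral_param _ _ _ _ R mu
  (fun zs : (R * R) * R => abelk r (zs.1.2 - zs.2) * (G zs.2 * abel_iter n zs.1.1 zs.2))).
apply: measurable_funM.
  apply: (measurableT_comp (measurable_abelk r)).
  apply: measurable_funB => //.
  exact: (measurableT_comp measurable_snd).
apply: measurable_funM; first exact: (measurableT_comp mG).
have mp : measurable_fun setT (fun zs : (R * R) * R => (zs.1.1, zs.2)).
  apply: measurable_fun_pair => //.
  exact: (measurableT_comp measurable_fst).
exact: (measurableT_comp IHn mp).
Qed.

Lemma measurable_abel_iter_l n t : measurable_fun setT (fun x => abel_iter n x t).
Proof. exact: (measurable_fun_pair1 t (measurable_abel_iter n)). Qed.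

Lemma measurable_abel_iter_r n x : measurable_fun setT (abel_iter n x).
Proof. exact: (measurable_fun_pair2 x (measurable_abel_iter n)). Qed.

(** The factor by which one convolution with the kernel multiplies [abel_weight], as an upper bound.
    It tends to 0 as c grows, through c^(-r). *)
Definition conv_cst c : R := 2 * 2^-1 `^ (r - 1) * (c `^ (- r) * Gamma r).

Lemma conv_cst_small (e : R) : 0 < e -> exists2 c : R, 0 < c & conv_cst c <= e.
Proof.
move=> e0; pose h : R := 2 * 2^-1 `^ (r - 1).
have h0 : 0 < h by rewrite mulr_gt0 ?powR_gt0 ?invr_gt0.
have eh : 0 < e / h by rewrite divr_gt0.
have [c c0] := integral_abelk_expR_small r0 r1 eh.
rewrite integral_abelk_expR// lee_fin => ce; exists c => //.
by rewrite /conv_cst -/h mulrC -ler_pdivlMr.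
Qed.

Definition abel_weight c x t : R := expR (c * (t - x)) * abelk r (t - x).

Lemma abel_weight_ge0 c x t : 0 <= abel_weight c x t.
Proof. by rewrite mulr_ge0 ?expR_ge0 ?abelk_ge0. Qed.

Lemma integral_weighted_conv_majorant c x t : 0 < c ->
  (\int[mu]_s (expR (c * (t - x)) * conv_majorant r c x t s)%:E =
   (conv_cst c * abel_weight c x t)%:E)%E.
Proof.
move=> c0; rewrite ge0_integralZl_real ?expR_ge0//; last 2 first.
- exact: measurable_conv_majorant.
- by move=> s; exact: conv_majorant_ge0.
rewrite integral_conv_majorant// -EFinM; congr (_%:E).
by rewrite /conv_cst /abel_weight; ring.
Qed.

(** Multiplying [abelk_mul_le_left] by e^(c(t-x)) turns the damping e^(-c(t-s)) into the weight
    e^(c(s-x)). *)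
Lemma abelk_weight_le c x t s : 0 < c ->
  abelk r (t - s) * abel_weight c x s <=
  expR (c * (t - x)) * conv_majorant r c x t s.
Proof.
move=> c0; have := abelk_mul_le_left x t s r1 (ltW c0).
move=> /(ler_wpM2l (expR_ge0 (c * (t - x)))); apply: le_trans.
rewrite [leRHS]mulrA -expRD.
rewrite (_ : c * (t - x) + - c * (t - s) = c * (s - x)); last by ring.
by rewrite /abel_weight mulrCA.
Qed.

(** Mirror image of [abelk_weight_le], with the exponential on the piece from s to t; it serves the
    unfolding from the left end. *)
Lemma weight_abelk_le c x t s : 0 < c ->
  abel_weight c s t * abelk r (s - x) <=
  expR (c * (t - x)) * conv_majorant r c x t s.
Proof.
move=> c0; have := abelk_mul_le_right x t s r1 (ltW c0).
move=> /(ler_wpM2l (expR_ge0 (c * (t - x)))); apply: le_trans.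
rewrite [leRHS]mulrA -expRD.
rewrite (_ : c * (t - x) + - c * (s - x) = c * (t - s)); last by ring.
by rewrite /abel_weight mulrA.
Qed.

Lemma measurable_weighted_conv_majorant c x t :
  measurable_fun setT (fun s => expR (c * (t - x)) * conv_majorant r c x t s).
Proof. by apply: measurable_funM => //; exact: measurable_conv_majorant. Qed.

Section bound.
Variables (c q : R).
Hypotheses (c0 : 0 < c) (cq : M * conv_cst c <= q).

Let q0 : 0 <= q.
Proof.
apply: le_trans cq; rewrite mulr_ge0// /conv_cst !mulr_ge0 ?powR_ge0//.
by rewrite ltW// Gamma_gt0.
Qed.

(** Each integration reproduces the weight at the cost of a factor M from [G] and [conv_cst c] from
    the kernel. The shape of the bound is the same for all n, so a plain induction closes. *)
Lemma abel_iter_le n x t : `|abel_iter n x t| <= q ^+ n * abel_weight c x t.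
Proof.
elim: n x t => [|n IHn] x t /=.
  rewrite expr0 mul1r ger0_norm ?abelk_ge0//.
  have [tx|/ltW tx] := leP (t - x) 0; first by rewrite abelk_le0E// abel_weight_ge0.
  rewrite -[leLHS]mul1r ler_wpM2r ?abelk_ge0// -expR0 ler_expR.
  by rewrite mulr_ge0// ltW.
have mE := measurable_weighted_conv_majorant c x t.
apply: (normr_Rintegral_le (m := mu) (g := fun s =>
  (M * q ^+ n) * (expR (c * (t - x)) * conv_majorant r c x t s))).
- apply: measurable_funM; first exact: measurable_abelk_rsub.
  by apply: measurable_funM => //; exact: measurable_abel_iter_r.
- exact: measurable_funM.
- move=> s; rewrite !normrM (ger0_norm (abelk_ge0 _ _)).
  apply: (@le_trans _ _ (abelk r (t - s) * (M * (q ^+ n * abel_weight c x s)))).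
    by rewrite ler_wpM2l ?abelk_ge0// ler_pM.
  rewrite (_ : _ * (M * _) =
    M * q ^+ n * (abelk r (t - s) * abel_weight c x s)); last by ring.
  by rewrite ler_wpM2l ?mulr_ge0 ?exprn_ge0// abelk_weight_le.
- rewrite ge0_integralZl_real ?mulr_ge0 ?exprn_ge0//; last first.
    by move=> s; rewrite mulr_ge0 ?expR_ge0 ?conv_majorant_ge0.
  rewrite integral_weighted_conv_majorant// -EFinM lee_fin exprS.
  rewrite (_ : M * _ * _ =
    (M * conv_cst c) * (q ^+ n * abel_weight c x t)); last by ring.
  by rewrite -[leRHS]mulrA ler_wpM2r// mulr_ge0 ?exprn_ge0 ?abel_weight_ge0.
Qed.

End bound.

Lemma integrable_abel_iter n x t :
  mu.-integrable setT (EFin \o (fun s => abelk r (t - s) * (G s * abel_iter n x s))).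
Proof.
have mE := measurable_weighted_conv_majorant 1 x t.
(* Mere integrability asks for no smallness, so the rate c = 1 is as good as any. *)
pose q := M * conv_cst 1.
have q0 : 0 <= q.
  by rewrite mulr_ge0// !mulr_ge0 ?powR_ge0//; apply/ltW/Gamma_gt0.
apply: (majorant_integrable (m := mu)
  (g := fun s => (M * q ^+ n) * (expR (1 * (t - x)) * conv_majorant r 1 x t s))
  (C := M * q ^+ n * (conv_cst 1 * abel_weight 1 x t))).
- apply: measurable_funM; first exact: measurable_abelk_rsub.
  by apply: measurable_funM => //; exact: measurable_abel_iter_r.
- exact: measurable_funM.
- move=> s; rewrite !normrM (ger0_norm (abelk_ge0 _ _)).
  apply: (@le_trans _ _ (abelk r (t - s) * (M * (q ^+ n * abel_weight 1 x s)))).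
    by rewrite ler_wpM2l ?abelk_ge0// ler_pM// abel_iter_le.
  rewrite (_ : _ * (M * _) =
    M * q ^+ n * (abelk r (t - s) * abel_weight 1 x s)); last by ring.
  by rewrite ler_wpM2l ?mulr_ge0 ?exprn_ge0// abelk_weight_le.
- rewrite ge0_integralZl_real ?mulr_ge0 ?exprn_ge0//; last first.
    by move=> s; rewrite mulr_ge0 ?expR_ge0 ?conv_majorant_ge0.
  by rewrite integral_weighted_conv_majorant// -EFinM.
Qed.

Lemma integrable_abel_iter_dual n x t :
  mu.-integrable setT (EFin \o (fun s => abelk r (s - x) * (G s * abel_iter n s t))).
Proof.
have mE := measurable_weighted_conv_majorant 1 x t.
pose q := M * conv_cst 1.
have q0 : 0 <= q.
  by rewrite mulr_ge0// !mulr_ge0 ?powR_ge0//; apply/ltW/Gamma_gt0.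
apply: (majorant_integrable (m := mu)
  (g := fun s => (M * q ^+ n) * (expR (1 * (t - x)) * conv_majorant r 1 x t s))
  (C := M * q ^+ n * (conv_cst 1 * abel_weight 1 x t))).
- apply: measurable_funM; first exact: measurable_abelk_sub.
  by apply: measurable_funM => //; exact: measurable_abel_iter_l.
- exact: measurable_funM.
- move=> s; rewrite !normrM (ger0_norm (abelk_ge0 _ _)).
  apply: (@le_trans _ _ (abelk r (s - x) * (M * (q ^+ n * abel_weight 1 s t)))).
    by rewrite ler_wpM2l ?abelk_ge0// ler_pM// abel_iter_le.
  rewrite (_ : _ * (M * _) =
    M * q ^+ n * (abel_weight 1 s t * abelk r (s - x))); last by ring.
  by rewrite ler_wpM2l ?mulr_ge0 ?exprn_ge0// weight_abelk_le.
- rewrite ge0_integralZl_real ?mulr_ge0 ?exprn_ge0//; last first.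
    by move=> s; rewrite mulr_ge0 ?expR_ge0 ?conv_majorant_ge0.
  by rewrite integral_weighted_conv_majorant// -EFinM.
Qed.

(* The iterates are integrals over simplices, so they can be unfolded from
   either end. *)
Lemma abel_iterSr n x t :
  abel_iter n.+1 x t = \int[mu]_s (abelk r (s - x) * (G s * abel_iter n s t)).
Proof.
elim: n x t => [|n IHn] x t.
  by apply: eq_Rintegral => s _ /=; ring.
(* The integrand with both outermost kernels visible. Integrating z.2 first gives the unfolding at t
   combined with the induction hypothesis; integrating z.1 first folds back the definition at t,
   leaving the kernel at x outside. *)
pose f (z : R * R) := (abelk r (t - z.1) * G z.1) *
   (abelk r (z.2 - x) * (G z.2 * abel_iter n z.2 z.1)).
transitivity (\int[mu]_s \int[mu]_u f (s, u)).
  transitivity (\int[mu]_s (abelk r (t - s) * (G s * abel_iter n.+1 x s))) => //.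
  apply: eq_Rintegral => s _; rewrite IHn mulrA -RintegralZl//.
  exact: integrable_abel_iter_dual.
transitivity (\int[mu]_u \int[mu]_s f (s, u)); last first.
  apply: eq_Rintegral => u _; rewrite [in RHS]/= mulrA -RintegralZl//.
    by apply: eq_Rintegral => s _; rewrite /f/=; ring.
  exact: integrable_abel_iter.
pose q := M * conv_cst 1.
have cst0 : 0 <= conv_cst 1.
  by rewrite !mulr_ge0 ?powR_ge0//; apply/ltW/Gamma_gt0.
have q0 : 0 <= q by rewrite mulr_ge0.
pose K := M * M * q ^+ n.
have K0 : 0 <= K by rewrite !mulr_ge0 ?exprn_ge0.
have mf : measurable_fun setT f.
  apply: measurable_funM.
    apply: measurable_funM; last exact: (measurableT_comp mG).
    exact: (measurableT_comp (measurable_abelk_rsub r t)).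
  apply: measurable_funM; first exact: (measurableT_comp (measurable_abelk_sub r x)).
  apply: measurable_funM; first exact: (measurableT_comp mG).
  have mp : measurable_fun setT (fun z : R * R => (z.2, z.1)).
    exact: measurable_fun_pair.
  exact: (measurableT_comp (measurable_abel_iter n) mp).
apply: Rintegral_Fubini; apply: (prod_majorant_integrable (m1 := mu) (m2 := mu)
  (phi := fun s => (K * conv_cst 1) * (expR (1 * (t - x)) * conv_majorant r 1 x t s))).
- exact: mf.
- by apply: measurable_funM => //; exact: measurable_weighted_conv_majorant.
- move=> s; have mE := measurable_weighted_conv_majorant 1 x s.
  apply: (@le_trans _ _ (\int[mu]_u (K * abelk r (t - s) *
    (expR (1 * (s - x)) * conv_majorant r 1 x s u))%:E)%E).
    apply: ge0_le_integral_EFin => //.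
    + by apply: measurableT_comp => //; exact: (measurable_fun_pair2 s mf).
    + exact: measurable_funM.
    + move=> u; rewrite /f/= !normrM !(ger0_norm (abelk_ge0 _ _)).
      apply: (@le_trans _ _ (abelk r (t - s) * M *
          (abelk r (u - x) * (M * (q ^+ n * abel_weight 1 u s))))).
        rewrite ler_pM ?mulr_ge0 ?abelk_ge0// ?ler_wpM2l ?abelk_ge0//.
        by rewrite ler_pM// abel_iter_le.
      rewrite (_ : abelk r (t - s) * M * _ =
        K * abelk r (t - s) * (abel_weight 1 u s * abelk r (u - x)));
        last by rewrite /K; ring.
      by rewrite ler_wpM2l ?mulr_ge0 ?abelk_ge0 ?exprn_ge0// weight_abelk_le.
  rewrite ge0_integralZl_real ?mulr_ge0 ?abelk_ge0 ?exprn_ge0//; last first.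
    by move=> u; rewrite mulr_ge0 ?expR_ge0 ?conv_majorant_ge0.
  rewrite integral_weighted_conv_majorant// -EFinM lee_fin.
  have -> : K * abelk r (t - s) * (conv_cst 1 * abel_weight 1 x s) =
      K * conv_cst 1 * (abelk r (t - s) * abel_weight 1 x s).
    by rewrite mulrACA.
  by rewrite ler_wpM2l ?(mulr_ge0 K0)// abelk_weight_le.
- have mE := measurable_weighted_conv_majorant 1 x t.
  rewrite ge0_integralZl_real ?(mulr_ge0 K0)//; last first.
    by move=> u; rewrite mulr_ge0 ?expR_ge0 ?conv_majorant_ge0.
  by rewrite integral_weighted_conv_majorant// -EFinM ltry.
Qed.

End peano_baker.

(** * Injectivity of the Abel transform *)

Section abel_injectivity.
Context {R : realType}.
Notation mu := (@lebesgue_measure R).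

Lemma ae_neq (b : R) : {ae mu, forall t, t != b}.
Proof.
exists [set b]; split => //; first exact: lebesgue_measure_set1.
by move=> t /= /negP/negPn/eqP.
Qed.

(** By Lebesgue differentiation f is almost everywhere the derivative of its primitive, which is
    constant on the open interval. *)
Lemma integral_locally_constant_ae0 (f : R -> R) (a b k : R) :
  mu.-integrable setT (EFin \o f) ->
  (forall x, a < x < b -> \int[mu]_(t in `]-oo, x]) f t = k) ->
  {ae mu, forall x, a < x < b -> f x = 0}.
Proof.
move=> intf Fk.
have intfy y : mu.-integrable `]-oo, y] (EFin \o f).
  by apply: integrableS intf.
have locf : locally_integrable setT f.
  by apply: open_integrable_locally => //; exact: openT.
have := FTC1Ny intfy locf.
apply: filterS; first exact: (ae_filter_ringOfSetsType mu).
move=> x [_ <-] /andP[ax xb]; rewrite derive1E.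
rewrite (@near_eq_derive _ _ _ _ (cst k)) ?derive_cst//.
have : x \in `]a, b[ by rewrite in_itv/= ax.
move=> /near_in_itvoo; apply: filterS => y; rewrite in_itv/=; exact: Fk.
Qed.

Variable r : R.
Hypotheses (r0 : 0 < r) (r1 : r < 1).

Lemma fineK_abel_beta : (fine (abel_beta r))%:E = abel_beta r.
Proof. by rewrite fineK// ge0_fin_numE ?abel_beta_lty// ltW// abel_beta_gt0. Qed.

Lemma abelk_beta_conv_fine (x y : R) :
  (\int[mu]_t (abelk (1 - r) (t - x) * abelk r (y - t))%:E =
   (if x < y then fine (abel_beta r) else 0)%:E)%E.
Proof.
case: ifPn => [xy|]; first by rewrite fineK_abel_beta abelk_beta_conv.
rewrite -leNgt => yx; rewrite integral0_eq// => t _.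
have [tx|xt] := leP t x; first by rewrite abelk_le0E ?mul0r// subr_le0.
by rewrite [abelk r _]abelk_le0E ?mulr0// subr_le0 (le_trans yx)// ltW.
Qed.

Lemma measurable_beta_integrand (x y : R) :
  measurable_fun setT (fun t : R => abelk (1 - r) (t - x) * abelk r (y - t)).
Proof.
by apply: measurable_funM;
  [exact: measurable_abelk_sub|exact: measurable_abelk_rsub].
Qed.

(* Abel inversion: the kernels of orders r and 1 - r convolve to a constant. *)
Lemma abel_integral_primitive (f : R -> R) (x : R) :
  mu.-integrable setT (EFin \o f) ->
  (forall t, mu.-integrable setT (EFin \o (fun s => abelk r (s - t) * f s))) ->
  \int[mu]_t (abelk (1 - r) (t - x) * \int[mu]_s (abelk r (s - t) * f s)) =
  fine (abel_beta r) * \int[mu]_(s in `]x, +oo[) f s.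
Proof.
move=> intf intk; set B := fine _.
have mf : measurable_fun setT f by apply/measurable_EFinP; case/integrableP : intf.
pose h (z : R * R) := abelk (1 - r) (z.2 - x) * (abelk r (z.1 - z.2) * f z.1).
have mh : measurable_fun setT h.
  apply: measurable_funM; first exact: (measurableT_comp (measurable_abelk_sub _ x)).
  apply: measurable_funM; last exact: (measurableT_comp mf).
  by apply: (measurableT_comp (measurable_abelk r)); exact: measurable_funB.
have hE s : (fun t => h (s, t)) =
    (fun t => f s * (abelk (1 - r) (t - x) * abelk r (s - t))).
  by apply/funext => t; rewrite /h/=; ring.
have mk := measurable_beta_integrand x.
have B0 : 0 <= B by rewrite fine_ge0// ltW// abel_beta_gt0.
have le_if (s : R) : 0 <= (if x < s then B else 0) <= B by case: ifP; rewrite lexx B0.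
have -> : \int[mu]_t (abelk (1 - r) (t - x) * \int[mu]_s (abelk r (s - t) * f s)) =
          \int[mu]_t \int[mu]_s h (s, t).
  by apply: eq_Rintegral => t _; rewrite -RintegralZl.
rewrite -Rintegral_Fubini; last first.
  (* Integrating the kernels over t first yields at most the Beta constant, so integrability of f
     alone justifies the exchange. *)
  apply: (prod_majorant_integrable (m1 := mu) (m2 := mu)
    (phi := fun s => B * `|f s|)) => //.
  - by apply: measurable_funM => //; exact: measurableT_comp.
  - move=> s.
    have -> : (\int[mu]_t `|h (s, t)|%:E =
        \int[mu]_t (`|f s| * (abelk (1 - r) (t - x) * abelk r (s - t)))%:E)%E.
      apply: eq_integral => t _; have := congr1 (fun F => F t) (hE s) => /= ->.
      by rewrite !normrM !(ger0_norm (abelk_ge0 _ _)).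
    rewrite ge0_integralZl_real//;
      [|exact: mk|by move=> t; rewrite mulr_ge0 ?abelk_ge0].
    rewrite abelk_beta_conv_fine -EFinM lee_fin mulrC ler_wpM2r//.
    by case/andP: (le_if s).
  - rewrite ge0_integralZl_real//; last exact: measurableT_comp.
    rewrite lte_mul_pinfty ?lee_fin//.
    by case/integrableP : intf.
transitivity (\int[mu]_s (B * (f \_ `]x, +oo[) s)).
  apply: eq_Rintegral => s _; rewrite hE RintegralZl//; last first.
    apply: (majorant_integrable (m := mu) (C := B)
      (g := fun t => abelk (1 - r) (t - x) * abelk r (s - t)));
      [exact: mk|exact: mk| |].
      by move=> t; rewrite ger0_norm// mulr_ge0 ?abelk_ge0.
    by rewrite abelk_beta_conv_fine lee_fin; case/andP: (le_if s).
  rewrite /Rintegral abelk_beta_conv_fine/= patchE.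
  case: ifPn => xs; first by rewrite mem_set/= ?in_itv/= ?xs// mulrC.
  by rewrite memNset/= ?mulr0// in_itv/= (negbTE xs).
rewrite RintegralZl//; first by rewrite -Rintegral_mkcond.
rewrite -restrict_EFin; apply/integrable_restrict => //.
by rewrite ?setTI ?setIT; apply: integrableS intf.
Qed.

(** The term in [beta] is the transform of a point mass at b. Inversion shows that f plus this mass
    has no mass beyond any x in [a, b). Since f has no atom, this forces f = 0 almost everywhere on
    the interval and then beta = 0. *)
Lemma abel_injective (f : R -> R) (beta a b : R) : a < b ->
  mu.-integrable setT (EFin \o f) ->
  (forall s, b < s -> f s = 0) ->
  (forall t, mu.-integrable setT (EFin \o (fun s => abelk r (s - t) * f s))) ->
  {ae mu, forall t, a < t < b ->
    beta * abelk r (b - t) + \int[mu]_s (abelk r (s - t) * f s) = 0} ->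
  beta = 0 /\ {ae mu, forall t, a < t < b -> f t = 0}.
Proof.
move=> ab intf fb intk E0.
have [B BE] : exists B, fine (abel_beta r) = B by exists (fine (abel_beta r)).
have mf : measurable_fun setT f by apply/measurable_EFinP; case/integrableP : intf.
have B0 : B != 0 by rewrite -BE gt_eqF// -lte_fin fineK_abel_beta abel_beta_gt0.
(* The hypothesis is multiplied by [abelk (1 - r) (t - x)] and integrated over t; both terms then
   carry the factor B, which cancels. *)
have tail x : a <= x < b -> \int[mu]_(s in `]x, +oo[) f s = - beta.
  move=> /andP[ax xb]; apply: (mulfI B0); rewrite -[in LHS]BE -abel_integral_primitive//.
  have int2 : \int[mu]_t (abelk (1 - r) (t - x) * abelk r (b - t)) = B.
    by rewrite /Rintegral abelk_beta_conv_fine xb BE.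
  rewrite mulrN -[B]int2 mulrC -mulNr -RintegralZl//; last first.
    apply: (majorant_integrable (m := mu) (C := B)
      (g := fun t => abelk (1 - r) (t - x) * abelk r (b - t))).
    - exact: measurable_beta_integrand.
    - exact: measurable_beta_integrand.
    - by move=> t; rewrite ger0_norm// mulr_ge0 ?abelk_ge0.
    - by rewrite abelk_beta_conv_fine xb BE.
  congr fine; apply: ae_eq_integral => //.
  - apply/measurable_EFinP; apply: measurable_funM => //.
      exact: measurable_abelk_sub.
    apply: (@measurable_Rintegral_param _ _ _ _ R mu
      (fun z : R * R => abelk r (z.2 - z.1) * f z.2)).
    apply: measurable_funM; last exact: (measurableT_comp mf).
    by apply: (measurableT_comp (measurable_abelk r)); exact: measurable_funB.
  - apply/measurable_EFinP; apply: measurable_funM => //.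
    exact: measurable_beta_integrand.
  - move: E0 (ae_neq b); apply: filterS2; first exact: (ae_filter_ringOfSetsType mu).
    move=> t Et tb _; congr (_%:E).
    have [tx|xt] := leP t x.
      by rewrite [abelk (1 - r) _]abelk_le0E ?subr_le0// !mul0r mulr0.
    have [bt|tb'] := ltP b t.
      rewrite [abelk r (b - t)]abelk_le0E ?subr_le0 ?(ltW bt)// !mulr0.
      rewrite [X in _ * X](_ : _ = 0) ?mulr0//.
      rewrite /Rintegral integral0_eq// => s _.
      have [st|ts] := leP s t; first by rewrite abelk_le0E ?mul0r// subr_le0.
      by rewrite fb ?mulr0// (lt_trans bt).
    have := Et; rewrite (le_lt_trans ax xt) lt_neqAle tb tb'.
    move=> /(_ isT) /eqP; rewrite addr_eq0 => /eqP E.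
    by rewrite -[X in _ * X]opprK -E; ring.
have headE x : a < x < b -> \int[mu]_(s in `]-oo, x]) f s = \int[mu]_s f s + beta.
  move=> /andP[ax xb]; rewrite -(setUv `]-oo, x]%classic) setCitvl Rintegral_setU//.
  - by rewrite tail ?(ltW ax)// addrNK.
  - by apply: integrableS intf => //; apply: measurableU.
  - by rewrite -setCitvl; apply/disj_setPS => y [].
have f0 := integral_locally_constant_ae0 intf headE.
(* The tail beyond a equals - beta, and f now vanishes almost everywhere there. *)
split=> //; apply/eqP; rewrite -oppr_eq0 -(tail a) ?lexx//.
apply/eqP; rewrite (_ : 0 = fine (\int[mu]_(s in `]a, +oo[) (0 : \bar R))%E);
  last by rewrite integral0.
congr fine; apply: ae_eq_integral => //.
- by apply/measurable_EFinP; exact: measurable_funTS.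
- move: f0 (ae_neq b); apply: filterS2; first exact: (ae_filter_ringOfSetsType mu).
  move=> s fs sb; rewrite /= in_itv/= andbT => as_; congr (_%:E).
  have [bs|sb'] := ltP b s; first exact: fb.
  by apply: fs; rewrite as_ lt_neqAle sb sb'.
Qed.

End abel_injectivity.

Lemma Rintegral_dominated_cvg d (T : measurableType d) (R : realType)
    (m : {measure set T -> \bar R}) (f_ : nat -> T -> R) (f g : T -> R) (C : R) :
  (forall n, measurable_fun setT (f_ n)) -> measurable_fun setT g ->
  (forall x, f_ ^~ x @ \oo --> f x) ->
  (forall n x, `|f_ n x| <= g x) -> (\int[m]_x (g x)%:E <= C%:E)%E ->
  \int[m]_x f_ n x @[n --> \oo] --> \int[m]_x f x.
Proof.
move=> mf_ mg f_f f_g gC.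
have mf : measurable_fun setT f by apply: measurable_fun_cvg => // x _; exact: f_f.
have g0 x : 0 <= g x by rewrite (le_trans _ (f_g 0%N x)).
have intg : m.-integrable setT (EFin \o g).
  by apply: (majorant_integrable mg mg _ gC) => x; rewrite ger0_norm.
have cvgE x : (f_ n x)%:E @[n --> \oo] --> (f x)%:E.
  by apply: cvg_EFin; [exact: nearW|exact: f_f].
have [intf _ cvgf] := @dominated_convergence _ _ _ m setT measurableT
  (fun n => EFin \o f_ n) (EFin \o f) (EFin \o g)
  (fun n => measurable_EFin_fun (mf_ n)) (measurable_EFin_fun mf)
  (aeW m (fun x _ => cvgE x)) intg
  (aeW m (fun x n _ => f_g n x)).
apply: fine_cvg; rewrite fineK; first exact: cvgf.
exact: (integrable_fin_num measurableT intf).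
Qed.

Lemma geometric_majorant_series (R : realType) (u : nat -> R) (K : R) :
  (forall k, `|u k| <= K * 2^-1 ^+ k) ->
  [/\ cvgn (series u), (forall n, `|series u n| <= 2 * K) &
      `|limn (series u)| <= 2 * K].
Proof.
move=> uK; have K0 : 0 <= K.
  by rewrite (le_trans (normr_ge0 (u 0%N)))// (le_trans (uK 0%N))// expr0 mulr1.
have h1 : `|2^-1 : R| < 1 by rewrite ger0_norm ?invr_ge0// invf_lt1// ltr1n.
have cvgu : cvgn (series u).
  apply: normed_cvg; apply: (series_le_cvg (v_ := geometric K 2^-1)) => //.
  - by move=> n /=.
  - by move=> n; rewrite /geometric/= mulr_ge0 ?exprn_ge0 ?invr_ge0.
  - exact: is_cvg_geometric_series.
have part n : `|series u n| <= 2 * K.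
  apply: (@le_trans _ _ (series (geometric K 2^-1) n)).
    rewrite /series/= (le_trans (ler_norm_sum _ _ _))//.
    by apply: ler_sum => k _; exact: uK.
  apply: (le_trans (geometric_le_lim _ K0 _ h1)); first by rewrite invr_gt0.
  by rewrite (_ : K / (1 - 2^-1) = 2 * K)//; field.
split=> //.
have cvgnu : cvgn (fun n => `|series u n|) by exact: is_cvg_norm.
have -> : `|limn (series u)| = limn (fun n => `|series u n|).
  by rewrite lim_norm.
by apply: limr_le => //; apply: nearW.
Qed.

(** * Scalar series of iterated fractional integrals *)

Section abel_series.
Context {R : realType}.
Notation mu := (@lebesgue_measure R).
Variables (r : R) (G : R -> R) (M : R).
Hypotheses (r0 : 0 < r) (r1 : r < 1).
Hypotheses (mG : measurable_fun setT G) (M0 : 0 <= M).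
Hypothesis GM : forall s, `|G s| <= M.
Implicit Type c : nat -> R.
Local Notation H := (abel_iter r G).

Definition abel_series c (x t : R) : R := limn (series (fun k => c k * H k x t)).

(** This class contains the entries of P A^k Q and is stable under the shift c k -> c (k+1). The
    ratio rho may be large, because the decay of the iterates can be made faster. *)
Definition geometric_bounded c := exists C rho : R,
  [/\ 0 <= C, 0 <= rho & forall k, `|c k| <= C * rho ^+ k].

Lemma geometric_bounded_shift c : geometric_bounded c ->
  geometric_bounded (fun k => c k.+1).
Proof.
move=> [C [rho [C0 rho0 cC]]]; exists (C * rho), rho; split; rewrite ?mulr_ge0// => k.
by rewrite -mulrA -exprS.
Qed.

Lemma abel_series_term_le c : geometric_bounded c -> exists w K : R,
  [/\ 0 < w, 0 <= K &
   forall k x t, `|c k * H k x t| <= (K * abel_weight r w x t) * 2^-1 ^+ k].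
Proof.
move=> [C [rho [C0 rho0 cC]]].
(* Chosen so that rho q <= 1/2; the + 1 here and in M + 1 avoids division by zero. *)
pose q : R := (2 * (rho + 1))^-1.
have rho1 : 0 < rho + 1 by rewrite ltr_wpDl.
have q0 : 0 < q by rewrite invr_gt0 mulr_gt0.
have M1 : 0 < M + 1 by rewrite ltr_wpDl.
have [w w0 wq] := conv_cst_small r0 r1 (divr_gt0 q0 M1).
have Mq : M * conv_cst r w <= q.
  move: wq; rewrite ler_pdivlMr// => /(le_trans _); apply.
  rewrite mulrC ler_wpM2l ?lerDl//.
  by rewrite !mulr_ge0 ?powR_ge0//; exact/ltW/Gamma_gt0.
have qrho : rho * q <= 2^-1.
  rewrite /q invfM mulrCA ler_piMr ?invr_ge0//.
  by rewrite ler_pdivrMr// mul1r lerDl.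
exists w, C; split=> // k x t; rewrite normrM.
have W0 := abel_weight_ge0 r w x t.
apply: (@le_trans _ _ ((C * rho ^+ k) * (q ^+ k * abel_weight r w x t))).
  by rewrite ler_pM// (abel_iter_le r0 r1 mG M0 GM w0 Mq).
rewrite (_ : C * _ * _ = C * abel_weight r w x t * (rho * q) ^+ k); last first.
  by rewrite exprMn; ring.
rewrite ler_wpM2l ?(mulr_ge0 C0)//. apply: lerXn2r => //; rewrite nnegrE.
  by rewrite mulr_ge0// ltW.
by rewrite invr_ge0.
Qed.

Lemma is_cvg_abel_series c x t : geometric_bounded c ->
  cvgn (series (fun k => c k * H k x t)).
Proof.
move=> /abel_series_term_le [w [K [_ _ cK]]].
by have [] := geometric_majorant_series (fun k => cK k x t).
Qed.

Lemma abel_series_le c : geometric_bounded c -> exists w K : R,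
  [/\ 0 < w, 0 <= K, 
   forall n x t, `|series (fun k => c k * H k x t) n| <= K * abel_weight r w x t &
   forall x t, `|abel_series c x t| <= K * abel_weight r w x t].
Proof.
move=> /abel_series_term_le [w [K [w0 K0 cK]]]; exists w, (2 * K).
split=> //; first by rewrite mulr_ge0.
- move=> n x t; have [_ h _] := geometric_majorant_series (fun k => cK k x t).
  by rewrite -mulrA.
- move=> x t; have [_ _ h] := geometric_majorant_series (fun k => cK k x t).
  by rewrite -mulrA.
Qed.

Lemma measurable_series_abel_iter c n t :
  measurable_fun setT (fun x => series (fun k => c k * H k x t) n).
Proof.
rewrite /series/=; apply: measurable_sum => k.
by apply: measurable_funM => //; exact: measurable_abel_iter_l.
Qed.

Lemma measurable_abel_series c t : geometric_bounded c ->
  measurable_fun setT (fun x => abel_series c x t).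
Proof.
move=> bc; apply: (measurable_fun_cvg
  (h := fun n x => series (fun k => c k * H k x t) n)) => //.
  by move=> n; exact: measurable_series_abel_iter.
by move=> x _; exact: is_cvg_abel_series.
Qed.

Lemma abel_series0 x t : abel_series (fun=> 0) x t = 0.
Proof.
rewrite /abel_series (_ : series _ = cst 0) ?lim_cst//.
by apply/funext => n; rewrite /series/= big1// => k _; rewrite mul0r.
Qed.

(** The dual Volterra equation. It holds for partial sums by [abel_iterSr], with n + 1 terms on the
    left against n terms of the shifted series under the integral. The bound of [abel_series_le],
    uniform in n, allows dominated convergence. *)
Lemma abel_seriesE c x t : geometric_bounded c ->
  abel_series c x t = c 0%N * abelk r (t - x) +
    \int[mu]_s (abelk r (s - x) * (G s * abel_series (fun k => c k.+1) s t)).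
Proof.
move=> bc; have bc' := geometric_bounded_shift bc; set c' := fun k => c k.+1.
pose S n s := series (fun k => c' k * H k s t) n.
have [w [K [w0 K0 SK _]]] := abel_series_le bc'.
pose g s := M * K * (expR (w * (t - x)) * conv_majorant r w x t s).
have mg : measurable_fun setT g.
  by apply: measurable_funM => //; exact: measurable_weighted_conv_majorant.
have gC : (\int[mu]_s (g s)%:E <= (M * K * (conv_cst r w * abel_weight r w x t))%:E)%E.
  rewrite ge0_integralZl_real ?mulr_ge0//; last 2 first.
  - exact: measurable_weighted_conv_majorant.
  - by move=> s; rewrite mulr_ge0 ?expR_ge0 ?conv_majorant_ge0.
  by rewrite integral_weighted_conv_majorant// -EFinM.
have mS n : measurable_fun setT (fun s : R => abelk r (s - x) * (G s * S n s)).
  apply: measurable_funM; first exact: measurable_abelk_sub.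
  by apply: measurable_funM => //; exact: measurable_series_abel_iter.
have Sg n s : `|abelk r (s - x) * (G s * S n s)| <= g s.
  rewrite !normrM (ger0_norm (abelk_ge0 _ _)).
  apply: (@le_trans _ _ (abelk r (s - x) * (M * (K * abel_weight r w s t)))).
    by rewrite ler_wpM2l ?abelk_ge0// ler_pM//; exact: SK.
  rewrite (_ : _ * (M * _) =
    M * K * (abel_weight r w s t * abelk r (s - x))); last by ring.
  by rewrite ler_wpM2l ?mulr_ge0// weight_abelk_le.
have ints n : mu.-integrable setT (EFin \o (fun s => abelk r (s - x) * (G s * S n s))).
  by apply: (majorant_integrable (m := mu) _ _ _ gC); [exact: mS|exact: mg|exact: Sg].
have SE n : series (fun k => c k * H k x t) n.+1 = c 0%N * abelk r (t - x) +
    \int[mu]_s (abelk r (s - x) * (G s * S n s)).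
  elim: n => [|n IHn].
    rewrite /series/= big_nat1 [X in _ + X](_ : _ = 0) ?addr0//.
    by rewrite /Rintegral integral0_eq// => s _; rewrite /S /series/= big_geq// !mulr0.
  have intn := integrable_abel_iter_dual r0 r1 mG M0 GM n x t.
  rewrite seriesSr IHn -addrA; congr (_ + _).
  rewrite (abel_iterSr r0 r1 mG M0 GM) -RintegralZl// -RintegralD//.
    by apply: eq_Rintegral => s _; rewrite /S seriesSr /c'; ring.
  exact: (integrableZl measurableT (c n.+1) intn).
have cvgS : \int[mu]_s (abelk r (s - x) * (G s * S n s)) @[n --> \oo] -->
    \int[mu]_s (abelk r (s - x) * (G s * abel_series c' s t)).
  apply: (Rintegral_dominated_cvg (m := mu) _ _ _ _ gC) => // s.
  by apply: cvgMr; apply: cvgMr; exact: is_cvg_abel_series.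
apply/cvg_lim => //; rewrite -cvg_shiftS.
rewrite (_ : [sequence _]_n = fun n => c 0%N * abelk r (t - x) +
    \int[mu]_s (abelk r (s - x) * (G s * S n s))); last exact/funext.
by apply: cvgD => //; exact: cvg_cst.
Qed.

Lemma abel_series_eq0_step (a b : R) c : a < b ->
  (forall s, s < a -> G s = 0) -> (forall s, b < s -> G s = 0) ->
  {ae mu, forall s, a < s < b -> G s != 0} ->
  geometric_bounded c ->
  {ae mu, forall x, a < x < b -> abel_series c x b = 0} ->
  c 0%N = 0 /\
  {ae mu, forall x, a < x < b -> abel_series (fun k => c k.+1) x b = 0}.
Proof.
move=> ab Ga Gb G0 bc F0; have bc' := geometric_bounded_shift bc.
pose f s := G s * abel_series (fun k => c k.+1) s b.
have mf : measurable_fun setT f.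
  by apply: measurable_funM => //; exact: measurable_abel_series.
have [w [K [w0 K0 _ FK]]] := abel_series_le bc'.
have fK s : `|f s| <= M * (K * abel_weight r w s b).
  by rewrite normrM ler_pM.
have intf : mu.-integrable setT (EFin \o f).
  (* The bound on f has a growing exponential e^(w(b-s)), whereas the integrable comparison function
     has e^(-w(b-s)). For s >= a their ratio is at most e^(2w(b-a)); for s < a, f vanishes. *)
  pose E := M * K * expR (2 * w * (b - a)).
  have E0 : 0 <= E by rewrite !mulr_ge0 ?expR_ge0.
  have mk : measurable_fun setT (fun s => abelk r s * expR (- w * s)).
    exact: measurable_abelk_expR.
  have mkb : measurable_fun setT (fun s : R => abelk r (b - s) * expR (- w * (b - s))).
    by apply: (measurableT_comp mk); exact: measurable_funB.
  apply: (majorant_integrable (m := mu)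
    (g := fun s => E * (abelk r (b - s) * expR (- w * (b - s))))
    (C := E * (w `^ (- r) * Gamma r))) => //.
  - exact: measurable_funM.
  - move=> s; have [sa|as_] := ltP s a.
      by rewrite /f Ga// mul0r normr0 mulr_ge0 ?mulr_ge0 ?abelk_ge0 ?expR_ge0.
    apply: (le_trans (fK s)); rewrite /abel_weight /E.
    rewrite (_ : M * K * _ * _ = M * (K * (expR (2 * w * (b - a)) *
      expR (- w * (b - s)) * abelk r (b - s)))); last by ring.
    rewrite ler_wpM2l// ler_wpM2l// ler_wpM2r ?abelk_ge0// -expRD ler_expR.
    have : w * (b - s) <= w * (b - a) by rewrite ler_wpM2l ?(ltW w0)//; lra.
    by rewrite mulNr -mulrA; lra.
  - rewrite ge0_integralZl_real//; last first.
      by move=> s; rewrite mulr_ge0 ?abelk_ge0 ?expR_ge0.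
    rewrite (@ge0_integral_reflect _ b (fun s => (abelk r s * expR (- w * s))%:E)).
    + by rewrite integral_abelk_expR.
    + exact: measurable_EFin_fun.
    + by move=> s; rewrite lee_fin mulr_ge0 ?abelk_ge0 ?expR_ge0.
have intk t : mu.-integrable setT (EFin \o (fun s => abelk r (s - t) * f s)).
  apply: (majorant_integrable (m := mu)
    (g := fun s => M * K * (expR (w * (b - t)) * conv_majorant r w t b s))
    (C := M * K * (conv_cst r w * abel_weight r w t b))).
  - by apply: measurable_funM => //; exact: measurable_abelk_sub.
  - by apply: measurable_funM => //; exact: measurable_weighted_conv_majorant.
  - move=> s; rewrite normrM (ger0_norm (abelk_ge0 _ _)).
    apply: (le_trans (ler_wpM2l (abelk_ge0 _ _) (fK s))).
    rewrite (_ : _ * (M * _) =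
      M * K * (abel_weight r w s b * abelk r (s - t))); last by ring.
    by rewrite ler_wpM2l ?mulr_ge0// weight_abelk_le.
  - rewrite ge0_integralZl_real ?mulr_ge0//; last 2 first.
    + exact: measurable_weighted_conv_majorant.
    + by move=> s; rewrite mulr_ge0 ?expR_ge0 ?conv_majorant_ge0.
    by rewrite integral_weighted_conv_majorant// -EFinM.
have fb s : b < s -> f s = 0 by move=> bs; rewrite /f Gb// mul0r.
have [|c0 f0] := @abel_injective _ r r0 r1 f (c 0%N) a b ab intf fb intk.
  move: F0; apply: filterS; first exact: (ae_filter_ringOfSetsType mu).
  by move=> x Fx xab; rewrite -abel_seriesE// Fx.
split=> //; move: f0 G0; apply: filterS2; first exact: (ae_filter_ringOfSetsType mu).
move=> s fs Gs sab; have /eqP := fs sab.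
by rewrite mulf_eq0 (negbTE (Gs sab)) => /eqP.
Qed.

Lemma abel_series_eq0 (a b : R) c : a < b ->
  (forall s, s < a -> G s = 0) -> (forall s, b < s -> G s = 0) ->
  {ae mu, forall s, a < s < b -> G s != 0} ->
  geometric_bounded c ->
  {ae mu, forall x, a < x < b -> abel_series c x b = 0} ->
  forall k, c k = 0.
Proof.
move=> ab Ga Gb G0 bc F0 k; elim: k c bc F0 => [|k IHk] c bc F0.
  by have [] := abel_series_eq0_step ab Ga Gb G0 bc F0.
have [_ F1] := abel_series_eq0_step ab Ga Gb G0 bc F0.
exact: (IHk _ (geometric_bounded_shift bc)).
Qed.

End abel_series.

(** * The state-transition matrix *)

Section matrix_series.
Context {R : realType}.

Lemma cvg_mx_entries m n (u : nat -> 'M[R]_(m, n)) (L : 'M[R]_(m, n)) :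
  (forall i j, u k i j @[k --> \oo] --> L i j) -> u k @[k --> \oo] --> L.
Proof.
move=> uL; apply/cvgrPdist_lt => e e0; near=> k.
rewrite -[ltLHS]/(mx_norm _) mx_normrE; apply/bigmax_ltP; split=> // ij _.
rewrite !mxE; move: ij; near: k; apply: filter_forall => -[i j] /=.
by have /cvgrPdist_lt := uL i j; apply.
Unshelve. all: by end_near. Qed.

Lemma geometric_bounded0 : geometric_bounded (fun=> 0 : R).
Proof. by exists 0, 0; split=> // k; rewrite normr0 mul0r. Qed.

Lemma geometric_boundedD (c c' : nat -> R) :
  geometric_bounded c -> geometric_bounded c' ->
  geometric_bounded (fun k => c k + c' k).
Proof.
move=> [C [rho [C0 rho0 cC]]] [C' [rho' [C'0 rho'0 cC']]].
have m0 : 0 <= Num.max rho rho' by rewrite le_max rho0.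
exists (C + C'), (Num.max rho rho'); split; rewrite ?addr_ge0// => k.
rewrite mulrDl (le_trans (ler_normD _ _))// lerD//.
  apply: (le_trans (cC k)); rewrite ler_wpM2l//.
  by apply: lerXn2r; rewrite ?nnegrE// le_max lexx.
apply: (le_trans (cC' k)); rewrite ler_wpM2l//.
by apply: lerXn2r; rewrite ?nnegrE// le_max lexx orbT.
Qed.

Lemma geometric_boundedZ (a : R) (c : nat -> R) :
  geometric_bounded c -> geometric_bounded (fun k => a * c k).
Proof.
move=> [C [rho [C0 rho0 cC]]]; exists (`|a| * C), rho; split; rewrite ?mulr_ge0// => k.
by rewrite normrM -mulrA ler_wpM2l.
Qed.

Lemma geometric_bounded_sum (I : finType) (c : I -> nat -> R) :
  (forall i, geometric_bounded (c i)) ->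
  geometric_bounded (fun k => \sum_i c i k).
Proof.
move=> bc; have h (s : seq I) : geometric_bounded (fun k => \sum_(i <- s) c i k).
  elim: s => [|i s IHs].
    by under eq_fun do rewrite big_nil; exact: geometric_bounded0.
  by under eq_fun do rewrite big_cons; exact: geometric_boundedD.
exact: h.
Qed.

Lemma geometric_bounded_mxexp d (A : 'M[R]_d) (i j : 'I_d) :
  geometric_bounded (fun k => (A ^+ k) i j).
Proof.
(* The sum of all absolute entries dominates every column sum, which is what the induction on k
   uses. *)
pose rho := \sum_l \sum_j `|A l j|.
exists 1, rho; split=> // [|k]; first by rewrite !sumr_ge0// => l _; rewrite sumr_ge0.
rewrite mul1r; elim: k i j => [|k IHk] i j.
  by rewrite expr0 mxE; case: eqP => _; rewrite ?normr1 ?normr0.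
rewrite exprSr mxE (le_trans (ler_norm_sum _ _ _))// exprSr /rho mulr_sumr.
apply: ler_sum => l _; rewrite normrM ler_pM//.
rewrite (bigD1 j)//= lerDl.
by rewrite sumr_ge0.
Qed.

Lemma geometric_bounded_mulmx d p q (A : 'M[R]_d) (P : 'M[R]_(p, d))
    (Q : 'M[R]_(d, q)) i j :
  geometric_bounded (fun k => (P *m A ^+ k *m Q) i j).
Proof.
under eq_fun do rewrite mxE; apply: geometric_bounded_sum => l.
under eq_fun do rewrite mulrC; apply: geometric_boundedZ.
under eq_fun do rewrite mxE; apply: geometric_bounded_sum => m.
by apply: geometric_boundedZ; exact: geometric_bounded_mxexp.
Qed.

End matrix_series.

Section transition_matrix.
Context {R : realType}.
Notation mu := (@lebesgue_measure R).
Variables (al a b : R) (g : R -> R).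
Hypotheses (al0 : 0 < al) (al1 : al < 1) (ab : a < b).
Hypothesis cg : {within `[a, b], continuous g}.

(* Dividing by Gamma al absorbs the constants of the Riemann-Liouville
   integrals; cutting off outside [a, b] lets all integrals run over R. *)
Definition scaled_coef : R -> R := (fun s => g s / Gamma al) \_ `[a, b].
Local Notation G := scaled_coef.
Local Notation H := (abel_iter al G).

Let Gam0 : 0 < Gamma al. Proof. exact: Gamma_gt0. Qed.

Lemma scaled_coefE s : a <= s -> s <= b -> G s = g s / Gamma al.
Proof. by move=> as_ sb; rewrite /G patchE mem_set//= in_itv/= as_. Qed.

Lemma measurable_scaled_coef : measurable_fun setT G.
Proof.
apply/measurable_restrict => //; rewrite setTI; apply: measurable_funM => //.
exact: subspace_continuous_measurable_fun.
Qed.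

Lemma scaled_coef_ltE s : s < a -> G s = 0.
Proof.
by move=> sa; rewrite /G patchE memNset//= in_itv/= leNgt sa.
Qed.

Lemma scaled_coef_gtE s : b < s -> G s = 0.
Proof.
by move=> bs; rewrite /G patchE memNset//= in_itv/= andbC leNgt bs.
Qed.

Lemma scaled_coef_bounded : exists2 M : R, 0 <= M & forall s, `|G s| <= M.
Proof.
have [c1 c1ab gc1] := EVT_max (ltW ab) cg.
have [c2 c2ab gc2] := EVT_min (ltW ab) cg.
exists ((`|g c1| + `|g c2|) / Gamma al); first by rewrite divr_ge0 ?addr_ge0// ltW.
move=> s; have [sa|as_] := ltP s a.
  by rewrite scaled_coef_ltE// normr0 divr_ge0 ?addr_ge0// ltW.
have [bs|sb] := ltP b s.
  by rewrite scaled_coef_gtE// normr0 divr_ge0 ?addr_ge0// ltW.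
rewrite scaled_coefE// normrM [`|_^-1|]ger0_norm ?invr_ge0 ?(ltW Gam0)//.
rewrite ler_wpM2r ?invr_ge0 ?(ltW Gam0)//.
have sab : s \in `[a, b] by rewrite in_itv/= as_.
have le1 := gc1 s sab; have le2 := gc2 s sab.
have n1 := normr_ge0 (g c1); have n2 := normr_ge0 (g c2).
have h1 := ler_norm (g c1); have := ler_norm (- g c2); rewrite normrN => h2.
by rewrite ler_norml; apply/andP; split; lra.
Qed.

Lemma abel_iter_out n x t : t <= x -> H n x t = 0.
Proof.
move=> tx; have [M M0 GM] := scaled_coef_bounded.
have := abel_iter_le al0 al1 measurable_scaled_coef M0 GM ltr01 (lexx _) n x t.
by rewrite /abel_weight [abelk _ _]abelk_le0E ?subr_le0// !mulr0 normr_le0 => /eqP.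
Qed.

(** [iterI] carries n + 1 factors 1 / Gamma al, one from its initial kernel and one per integration.
    The latter n are inside [scaled_coef], so one remains. *)
Lemma iterI_abel_iter n x t : a <= x -> x <= t -> t <= b ->
  iterI al x g n t = (Gamma al)^-1 * H n x t.
Proof.
move=> ax; have al1n : al - 1 != 0 by rewrite subr_eq0 lt_eqF.
elim: n t => [|n IHn] t xt tb.
  rewrite /= mulrC; congr (_ * _); rewrite /abelk; case: ifPn => // /negP.
  rewrite subr_gt0 => /negP; rewrite -leNgt => tx.
  (* On the diagonal both kernels take the default value 0, since al - 1 is nonzero. *)
  by have -> : t = x; [apply/eqP; rewrite eq_le tx|rewrite subrr powR0].
rewrite [LHS]/= /rl_integral; congr (_ * _).
rewrite -[H n.+1 x t]/(\int[mu]_s (abelk al (t - s) * (G s * H n x s))).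
rewrite Rintegral_mkcond; apply: eq_Rintegral => s _; rewrite patchE.
case: ifPn => [|].
  rewrite inE/= in_itv/= => /andP[xs st].
  have -> : (t - s) `^ (al - 1) = abelk al (t - s).
    move: st; rewrite le_eqVlt => /orP[/eqP ->|st].
      by rewrite subrr abelk_le0E// powR0.
    by rewrite abelk_gt0E// subr_gt0.
  rewrite IHn ?(le_trans st)// scaled_coefE ?(le_trans ax)// ?(le_trans st)//.
  by rewrite [X in _ * X]mulrA.
rewrite notin_setE/= in_itv/= => /negP; rewrite negb_and -!ltNge => /orP[sx|ts].
  by rewrite abel_iter_out ?mulr0// ltW.
by rewrite abelk_le0E ?mul0r// subr_le0 ltW.
Qed.

Variables (d : nat) (A : 'M[R]_d).

Lemma cvg_Phi x t : a <= x -> x <= t -> t <= b ->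
  series (fun k => iterI al x g k t *: A ^+ k) n @[n --> \oo] --> Phi al A g x t.
Proof.
move=> ax xt tb; have [M M0 GM] := scaled_coef_bounded.
have mG := measurable_scaled_coef.
suff cvgS : series (fun k => iterI al x g k t *: A ^+ k) n @[n --> \oo] -->
    \matrix_(i, j) ((Gamma al)^-1 * abel_series al G (fun k => (A ^+ k) i j) x t).
  rewrite /Phi (cvg_lim _ cvgS)//; exact: norm_hausdorff.
apply: cvg_mx_entries => i j; rewrite mxE.
have -> : (fun n => series (fun k => iterI al x g k t *: A ^+ k) n i j) =
   (fun n => (Gamma al)^-1 * series (fun k => (A ^+ k) i j * H k x t) n).
  apply/funext => n; rewrite /series/= summxE mulr_sumr; apply: eq_bigr => k _.
  by rewrite mxE iterI_abel_iter//; ring.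
apply: cvgMr; apply: (is_cvg_abel_series al0 al1 mG M0 GM).
exact: geometric_bounded_mxexp.
Qed.

(** The bridge from matrices to scalars. It is used with P the identity to describe the response,
    and with P a row vector v to test which directions are unreachable. *)
Lemma mulmx_PhiE p q (P : 'M[R]_(p, d)) (Q : 'M[R]_(d, q)) i j x t :
  a <= x -> x <= t -> t <= b ->
  (P *m Phi al A g x t *m Q) i j =
  (Gamma al)^-1 * abel_series al G (fun k => (P *m A ^+ k *m Q) i j) x t.
Proof.
move=> ax xt tb; have [M M0 GM] := scaled_coef_bounded.
have mG := measurable_scaled_coef.
pose S := series (fun k => iterI al x g k t *: A ^+ k).
have cvg1 : (P *m S n *m Q) i j @[n --> \oo] --> (P *m Phi al A g x t *m Q) i j.
  rewrite mxE; under eq_fun do rewrite mxE.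
  apply: cvg_big => [|l _]; [exact: add_continuous|]; apply: cvgMl.
  rewrite mxE; under eq_fun do rewrite mxE.
  apply: cvg_big => [|m _]; [exact: add_continuous|]; apply: cvgMr.
  exact: (continuous_cvg _ (@coord_continuous _ _ _ m l _) (cvg_Phi ax xt tb)).
have cvg2 : (P *m S n *m Q) i j @[n --> \oo] -->
    (Gamma al)^-1 * abel_series al G (fun k => (P *m A ^+ k *m Q) i j) x t.
  have -> : (fun n => (P *m S n *m Q) i j) =
    (fun n => (Gamma al)^-1 * series (fun k => (P *m A ^+ k *m Q) i j * H k x t) n).
    apply/funext => n; rewrite /S /series/= mulmx_sumr mulmx_suml summxE mulr_sumr.
    apply: eq_bigr => k _; rewrite -scalemxAr -scalemxAl mxE iterI_abel_iter//.
    by ring.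
  apply: cvgMr; apply: (is_cvg_abel_series al0 al1 mG M0 GM).
  exact: geometric_bounded_mulmx.
exact: (cvg_unique _ cvg1 cvg2).
Qed.

End transition_matrix.

(** * The Kalman matrix and the Gramian *)

Section kalman_algebra.
Variables (F : fieldType) (d N : nat).
Implicit Types (A : 'M[F]_d) (B : 'M[F]_(d, N)) (v : 'rV[F]_d).

(** Modulo the characteristic polynomial, X^k has a remainder of degree less than d, and by
    Cayley-Hamilton this remainder has the same value at A. *)
Lemma mulmx_exp_Cayley_Hamilton A B v :
  (forall k, (k < d)%N -> v *m A ^+ k *m B = 0) ->
  forall k, v *m A ^+ k *m B = 0.
Proof.
case: d A B v => [|d'] A B v vAB k; first by rewrite thinmx0 !mul0mx.
pose p := 'X^k %% char_poly A.
have cp0 : char_poly A != 0 by rewrite -size_poly_gt0 size_char_poly.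
have sp : (size p <= d'.+1)%N by rewrite -ltnS -(size_char_poly A) ltn_modp.
have -> : A ^+ k = horner_mx A p.
  have -> : A ^+ k = horner_mx A 'X^k by rewrite rmorphXn/= horner_mx_X.
  rewrite [in LHS](divp_eq 'X^k (char_poly A)) rmorphD rmorphM/=.
  by rewrite Cayley_Hamilton mulr0 add0r.
rewrite -[p]coefK poly_def rmorph_sum/= mulmx_sumr mulmx_suml big1// => i _.
rewrite -mul_polyC rmorphM/= rmorphXn/= horner_mx_C horner_mx_X.
rewrite -mulmxE mul_scalar_mx -scalemxAr -scalemxAl vAB ?scaler0//.
exact: leq_trans (ltn_ord i) sp.
Qed.

End kalman_algebra.

Lemma kalman_matrix_eq0 (R : realType) (d N : nat) (A : 'M[R]_d) (B : 'M[R]_(d, N))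
    (v : 'rV[R]_d) :
  v *m kalman_matrix A B = 0 <-> forall k, v *m A ^+ k *m B = 0.
Proof.
rewrite /kalman_matrix mul_mxrow; split=> [vK|vAB].
  apply: mulmx_exp_Cayley_Hamilton => k kd.
  rewrite -mulmxA -[LHS](mxrowK (fun k : 'I_d => v *m (A ^+ k *m B)) (Ordinal kd)).
  by rewrite vK; apply/matrixP => i j; rewrite !mxE.
by under eq_mxrow do rewrite mulmxA vAB; rewrite mxrow0.
Qed.

Section Rintegral_sum.
Context d (T : measurableType d) (R : realType) (m : {measure set T -> \bar R}).
Variables (D : set T) (mD : measurable D).

Lemma integrable_sumEFin (I : Type) (s : seq I) (f : I -> T -> R) :
  (forall i, m.-integrable D (EFin \o f i)) ->
  m.-integrable D (EFin \o (fun x => \sum_(i <- s) f i x)).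
Proof.
move=> intf; apply: (eq_integrable mD (fun x => \sum_(i <- s) (f i x)%:E)%E).
  by move=> x _; rewrite /= sumEFin.
by apply: integrable_sum => // i _; exact: intf.
Qed.

Lemma Rintegral_sum (I : Type) (s : seq I) (f : I -> T -> R) :
  (forall i, m.-integrable D (EFin \o f i)) ->
  \int[m]_(x in D) (\sum_(i <- s) f i x) = \sum_(i <- s) \int[m]_(x in D) f i x.
Proof.
move=> intf; elim: s => [|i s IHs].
  rewrite big_nil /Rintegral integral0_eq// => x _.
  by rewrite big_nil.
rewrite big_cons -IHs -RintegralD//; last exact: integrable_sumEFin.
by apply: eq_Rintegral => x _; rewrite big_cons.
Qed.

End Rintegral_sum.

(** * Admissible controls and the weighted Gramian *)

Section control_response.
Context {R : realType}.
Notation mu := (@lebesgue_measure R).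
Variables (al a b : R) (g : R -> R).
Hypotheses (al0 : 0 < al) (al1 : al < 1) (ab : a < b).
Hypothesis cg : {within `[a, b], continuous g}.
Variables (d N : nat) (A : 'M[R]_d) (B : 'M[R]_(d, N)).
Local Notation G := (scaled_coef al a b g).

(** A version of the entries of [Phi al A g x t *m B] that is measurable on the whole line; the two
    are identified only for a <= x <= t <= b. *)
Definition response (t : R) (i : 'I_d) (l : 'I_N) (x : R) : R :=
  (Gamma al)^-1 * abel_series al G (fun k => (A ^+ k *m B) i l) x t.

Lemma responseE t i l x : a <= x -> x <= t -> t <= b ->
  (Phi al A g x t *m B) i l = response t i l x.
Proof.
move=> ax xt tb; have := mulmx_PhiE al0 al1 ab cg A 1%:M B i l ax xt tb.
by rewrite mul1mx => ->; under eq_fun do rewrite mul1mx.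
Qed.

Let bounded_powers i l : geometric_bounded (fun k => (A ^+ k *m B) i l).
Proof.
have := geometric_bounded_mulmx A 1%:M B i l.
by under eq_fun do rewrite mul1mx.
Qed.

Lemma measurable_response t i l : measurable_fun setT (response t i l).
Proof.
have [M M0 GM] := scaled_coef_bounded al0 al1 ab cg.
apply: measurable_funM => //.
exact: (measurable_abel_series al0 al1 (measurable_scaled_coef al cg) M0 GM t
  (bounded_powers i l)).
Qed.

Lemma response_le : exists2 K : R, 0 <= K & forall t i l x, a <= x -> t <= b ->
  `|response t i l x| <= K * abelk al (t - x).
Proof.
have [M M0 GM] := scaled_coef_bounded al0 al1 ab cg.
have mG := measurable_scaled_coef al cg.
have Gam0 := Gamma_gt0 al0 al1.
have KP0 i l : exists K : R, 0 <= K /\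
    forall t x, a <= x -> t <= b -> `|response t i l x| <= K * abelk al (t - x).
  have [w [K [w0 K0 _ FK]]] := abel_series_le al0 al1 mG M0 GM (bounded_powers i l).
  exists ((Gamma al)^-1 * (K * expR (w * (b - a)))); split.
    by rewrite !mulr_ge0 ?invr_ge0 ?expR_ge0// ltW.
  move=> t x ax tb; rewrite normrM [`|_^-1|]ger0_norm ?invr_ge0 ?(ltW Gam0)//.
  rewrite -[leRHS]mulrA ler_wpM2l ?invr_ge0 ?(ltW Gam0)//.
  apply: (le_trans (FK x t)); rewrite -[leRHS]mulrA ler_wpM2l//.
  by rewrite ler_wpM2r ?abelk_ge0// ler_expR ler_wpM2l ?(ltW w0)//; lra.
have [K KP] := fin_all_exists (fun i => fin_all_exists (KP0 i)).
exists (\sum_i \sum_l K i l).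
  by rewrite sumr_ge0// => i _; rewrite sumr_ge0// => l _; have [] := KP i l.
move=> t i l x ax tb; have [_ h] := KP i l; apply: (le_trans (h t x ax tb)).
rewrite ler_wpM2r ?abelk_ge0// (bigD1 i)//= (bigD1 l)//= -addrA lerDl addr_ge0//.
  by rewrite sumr_ge0// => l' _; have [] := KP i l'.
rewrite sumr_ge0// => i' _; rewrite sumr_ge0// => l' _; by have [] := KP i' l'.
Qed.

Lemma abelk_majorant_integrable (f : R -> R) (C t : R) : 0 <= C -> t <= b ->
  measurable_fun setT f ->
  (forall x, a <= x -> x <= t -> `|f x| <= C * abelk al (t - x)) ->
  mu.-integrable `[a, t] (EFin \o f).
Proof.
move=> C0 tb mf fC; apply/integrable_mkcond => //; rewrite restrict_EFin.
(* The kernel alone is not integrable at infinity. On [a, t] inserting e^(-(t-x)) costs at most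
   e^(b-a), and the resulting integral is known. *)
pose E := C * expR (b - a).
have mk : measurable_fun setT (fun x => abelk al x * expR (- 1 * x)).
  exact: measurable_abelk_expR.
have mkt : measurable_fun setT (fun x : R => abelk al (t - x) * expR (- 1 * (t - x))).
  by apply: (measurableT_comp mk); exact: measurable_funB.
apply: (majorant_integrable (m := mu)
  (g := fun x => E * (abelk al (t - x) * expR (- 1 * (t - x))))
  (C := E * (1 `^ (- al) * Gamma al))).
- by apply/measurable_restrict => //; exact: measurable_funTS.
- exact: measurable_funM.
- move=> x; rewrite patchE; case: ifPn => [|_]; last first.
    by rewrite normr0 mulr_ge0 ?mulr_ge0 ?expR_ge0 ?abelk_ge0.
  rewrite inE/= in_itv/= => /andP[ax xt]; apply: (le_trans (fC x ax xt)).
  rewrite /E -mulrA ler_wpM2l// mulrCA ler_peMr ?abelk_ge0//.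
  by rewrite -expRD -[leLHS]expR0 ler_expR; lra.
- rewrite ge0_integralZl_real ?mulr_ge0 ?expR_ge0//; last first.
    by move=> x; rewrite mulr_ge0 ?abelk_ge0 ?expR_ge0.
  rewrite (@ge0_integral_reflect _ t (fun x => (abelk al x * expR (- 1 * x))%:E)).
  + by rewrite integral_abelk_expR.
  + exact: measurable_EFin_fun.
  + by move=> x; rewrite lee_fin mulr_ge0 ?abelk_ge0 ?expR_ge0.
Qed.

Lemma bounded_control_function (u : R -> 'cV[R]_N) (U : R) : 0 <= U ->
  (forall j, measurable_fun setT (fun x => u x j 0)) ->
  (forall x j, a <= x -> x <= b -> `|u x j 0| <= U) ->
  control_function al a b A B g u.
Proof.
move=> U0 mu_ uU; split=> [j|t i]; first exact: measurable_funTS.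
rewrite in_itv/= => /andP[at_ tb].
have [K K0 respK] := response_le.
pose f x := \sum_l response t i l x * u x l 0.
apply: (@eq_integrable _ _ _ mu `[a, t]%classic _ (EFin \o f)).
  exact: measurable_itv.
  move=> x; rewrite inE/= in_itv/= => /andP[ax xt]; congr (_%:E).
  by rewrite mxE; apply: eq_bigr => l _; rewrite responseE.
apply: (@abelk_majorant_integrable f (\sum_(l < N) K * U)) => //.
- by rewrite sumr_ge0// => l _; rewrite mulr_ge0.
- apply: measurable_sum => l; apply: measurable_funM => //.
  exact: measurable_response.
- move=> x ax xt; rewrite /f (le_trans (ler_norm_sum _ _ _))// mulr_suml.
  apply: ler_sum => l _; rewrite normrM mulrAC ler_pM//; first exact: respK.
  by rewrite uU// (le_trans xt).
Qed.

(* The weight compensates the singularity of one of the two responses at b, so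
   that the corresponding control is bounded. *)
Definition gramian_density (i j : 'I_d) (x : R) : R :=
  (b - x) `^ (1 - al) * \sum_l response b i l x * response b j l x.

Definition gramian : 'M[R]_d :=
  \matrix_(i, j) \int[mu]_(x in `[a, b]) gramian_density i j x.

Lemma weight_abelk_le1 x : x <= b -> 0 <= (b - x) `^ (1 - al) * abelk al (b - x) <= 1.
Proof.
rewrite le_eqVlt => /orP[/eqP ->|xb].
  by rewrite subrr abelk_le0E// mulr0 lexx ler01.
have bx : 0 < b - x by rewrite subr_gt0.
rewrite abelk_gt0E// -powRD ?(gt_eqF bx) ?implybT//.
by rewrite (_ : 1 - al + (al - 1) = 0) ?powRr0 ?ler01 ?lexx//; ring.
Qed.

Let measurable_weight : measurable_fun setT (fun x : R => (b - x) `^ (1 - al)).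
Proof.
apply: (measurableT_comp (measurable_powR (1 - al))).
exact: measurable_funB.
Qed.

Lemma measurable_gramian_density i j : measurable_fun setT (gramian_density i j).
Proof.
apply: measurable_funM; first exact: measurable_weight.
apply: measurable_sum => l; apply: measurable_funM; exact: measurable_response.
Qed.

Lemma integrable_gramian_density i j :
  mu.-integrable `[a, b] (EFin \o gramian_density i j).
Proof.
have [K K0 respK] := response_le.
apply: (@abelk_majorant_integrable _ (\sum_(l < N) K * K)) => //.
- by rewrite sumr_ge0// => l _; rewrite mulr_ge0.
- exact: measurable_gramian_density.
- move=> x ax xb; have /andP[w0 w1] := weight_abelk_le1 xb.
  rewrite normrM (ger0_norm (powR_ge0 _ _)).
  apply: (@le_trans _ _ ((b - x) `^ (1 - al) *
     \sum_(l < N) (K * abelk al (b - x)) * (K * abelk al (b - x)))).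
    rewrite ler_wpM2l ?powR_ge0// (le_trans (ler_norm_sum _ _ _))//.
    by apply: ler_sum => l _; rewrite normrM ler_pM// respK.
  rewrite mulr_sumr mulr_suml; apply: ler_sum => l _.
  rewrite (_ : _ * _ = (b - x) `^ (1 - al) * abelk al (b - x) *
    (K * K * abelk al (b - x))); last by ring.
  by rewrite ler_piMl ?mulr_ge0 ?abelk_ge0.
Qed.

Lemma gramian_mulE (eta : 'cV[R]_d) i :
  (gramian *m eta) i 0 =
  \int[mu]_(x in `[a, b]) \sum_j gramian_density i j x * eta j 0.
Proof.
rewrite Rintegral_sum//; last first.
  move=> j; apply: (@eq_integrable _ _ _ mu `[a, b]%classic _
    (fun x => (eta j 0)%:E * (gramian_density i j x)%:E)%E) => //.
    by move=> x _; rewrite /= mulrC.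
  by apply: integrableZl => //; exact: integrable_gramian_density.
rewrite mxE; apply: eq_bigr => j _; rewrite mxE RintegralZr//.
exact: integrable_gramian_density.
Qed.

End control_response.

Section gramian_unit.
Context {R : realType}.
Notation mu := (@lebesgue_measure R).
Variables (al a b : R) (g : R -> R).
Hypotheses (al0 : 0 < al) (al1 : al < 1) (ab : a < b).
Hypothesis cg : {within `[a, b], continuous g}.
Hypothesis g_neq0 : {ae mu, forall t, t \in `[a, b] -> g t != 0}.
Variables (d N : nat) (A : 'M[R]_d) (B : 'M[R]_(d, N)).

(** This exhibits the quadratic form of the Gramian density as a weight times the squared norm of v
    Phi(x, b) B. *)
Lemma gramian_quadratic (v : 'rV[R]_d) x :
  \sum_i v 0 i * (\sum_j gramian_density al a b g A B i j x * v 0 j) =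
  (b - x) `^ (1 - al) *
    \sum_l (\sum_i v 0 i * response al a b g A B b i l x) ^+ 2.
Proof.
pose p i l := response al a b g A B b i l x.
transitivity (\sum_i \sum_j \sum_l
    (b - x) `^ (1 - al) * ((v 0 i * p i l) * (v 0 j * p j l))).
  apply: eq_bigr => i _; rewrite mulr_sumr; apply: eq_bigr => j _.
  rewrite /gramian_density mulr_sumr mulr_suml mulr_sumr.
  by apply: eq_bigr => l _; rewrite /p; ring.
rewrite mulr_sumr; under eq_bigr do rewrite exchange_big/=.
rewrite exchange_big/=; apply: eq_bigr => l _.
rewrite expr2 mulr_suml mulr_sumr; apply: eq_bigr => i _.
by rewrite mulr_sumr mulr_sumr.
Qed.

(** If v is in the left kernel, the integral of the nonnegative form vanishes, so v Phi(x, b) B = 0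
    for almost every x. [abel_series_eq0] then gives v A^k B = 0 for all k. *)
Lemma gramian_unit :
  (forall v : 'rV[R]_d, (forall k, v *m A ^+ k *m B = 0) -> v = 0) ->
  gramian al a b g A B \in unitmx.
Proof.
move=> obs; rewrite -row_free_unit -kermx_eq0; apply/rowV0P => v /sub_kermxP vW0.
apply: obs.
pose S x := \sum_i v 0 i * (\sum_j gramian_density al a b g A B i j x * v 0 j).
have intdv i : mu.-integrable `[a, b]
    (EFin \o (fun x => \sum_j gramian_density al a b g A B i j x * v 0 j)).
  apply: integrable_sumEFin => // j.
  apply: (@eq_integrable _ _ _ mu `[a, b]%classic _
    (fun x => (v 0 j)%:E * (gramian_density al a b g A B i j x)%:E)%E) => //.
    by move=> x _; rewrite /= mulrC.
  by apply: integrableZl => //; exact: integrable_gramian_density.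
have intSi i : mu.-integrable `[a, b]
    (EFin \o (fun x => v 0 i * \sum_j gramian_density al a b g A B i j x * v 0 j)).
  exact: (integrableZl _ (v 0 i) (intdv i)).
have intS : mu.-integrable `[a, b] (EFin \o S) by exact: integrable_sumEFin.
have S0 x : 0 <= S x.
  rewrite /S gramian_quadratic mulr_ge0 ?powR_ge0// sumr_ge0// => l _.
  exact: sqr_ge0.
have IS0 : \int[mu]_(x in `[a, b]) S x = 0.
  rewrite /S Rintegral_sum//.
  have -> : \sum_i \int[mu]_(x in `[a, b])
      (v 0 i * \sum_j gramian_density al a b g A B i j x * v 0 j) =
      (v *m gramian al a b g A B *m v^T) 0 0.
    rewrite -mulmxA mxE; apply: eq_bigr => i _.
    rewrite RintegralZl// gramian_mulE//; congr (_ * _).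
    by apply: eq_Rintegral => x _; apply: eq_bigr => j _; rewrite mxE.
  by rewrite vW0 mul0mx mxE.
have S0ae : {ae mu, forall x, x \in `[a, b] -> S x = 0}.
  have mS : measurable_fun `[a, b] (EFin \o S) by case/integrableP : intS.
  have absS : (\int[mu]_(x in `[a, b]) `|(EFin \o S) x| = 0)%E.
    under eq_integral do rewrite /= ger0_norm//.
    rewrite -[LHS]fineK; last exact: (integrable_fin_num _ intS).
    by congr EFin.
  have : {ae mu, forall x, `[a, b]%classic x -> (EFin \o S) x = cst 0%E x}.
    exact: ((ae_eq_integral_abs mu (measurable_itv _) mS).1 absS).
  apply: filterS; first exact: (ae_filter_ringOfSetsType mu).
  by move=> x Sx xab; have [] := Sx xab.
(* For a fixed column l, the entries of v A^k B are the coefficients of one scalar series, which is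
   shown to vanish almost everywhere. *)
move=> k; apply/matrixP => i l; rewrite ord1 [RHS]mxE; move: k.
have [M M0 GM] := scaled_coef_bounded al0 al1 ab cg.
have Gam0 := Gamma_gt0 al0 al1.
apply: (abel_series_eq0 al0 al1 (measurable_scaled_coef al cg) M0 GM ab).
- exact: scaled_coef_ltE.
- exact: scaled_coef_gtE.
- move: g_neq0; apply: filterS; first exact: (ae_filter_ringOfSetsType mu).
  move=> s gs /andP[as_ sb]; rewrite scaled_coefE ?ltW//.
  apply: mulf_neq0; first by apply: gs; rewrite in_itv/= !ltW.
  by rewrite invr_eq0 gt_eqF.
- exact: geometric_bounded_mulmx.
- move: S0ae; apply: filterS; first exact: (ae_filter_ringOfSetsType mu).
  move=> x Sx /andP[ax xb].
  have Gx : (Gamma al)^-1 != 0 by rewrite invr_eq0 gt_eqF.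
  apply: (mulfI Gx); rewrite mulr0.
  rewrite -(mulmx_PhiE al0 al1 ab cg A v B 0 l (ltW ax) (ltW xb) (lexx _)).
  have := Sx; rewrite in_itv/= !ltW// => /(_ isT)/eqP.
  rewrite /S gramian_quadratic mulf_eq0 gt_eqF ?powR_gt0 ?subr_gt0//=.
  rewrite psumr_eq0; last by move=> l' _; exact: sqr_ge0.
  move=> /allP/(_ l (mem_index_enum _)); rewrite sqrf_eq0 => /eqP h.
  rewrite -mulmxA mxE -[RHS]h; apply: eq_bigr => m _.
  by rewrite (responseE al0 al1 ab cg)// ltW.
Qed.

End gramian_unit.

Theorem theorem3p4 (R : realType) (d N : nat) (al a b : R)
    (A : 'M[R]_d) (B : 'M[R]_(d, N)) (g : R -> R) (y0 : 'cV[R]_d)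
    (al_gt0 : 0 < al) (al_lt1 : al < 1) (a_lt_b : a < b)
    (A_sym : A^T = A)
    (g_cont : {within `[a, b], continuous g})
    (g_neq0 : {ae @lebesgue_measure R, forall t, t \in `[a, b] -> g t != 0}) :
  controllable al a b A B g y0 <-> \rank (kalman_matrix A B) = d.
Proof.
have lab := ltW a_lt_b.
split=> [ctrl|rkd]; last first.
  have Wu : gramian al a b g A B \in unitmx.
    apply: gramian_unit => // v /kalman_matrix_eq0 vK.
    have rfK : row_free (kalman_matrix A B) by rewrite /row_free rkd.
    by apply/eqP; rewrite -(mulmx_free_eq0 v rfK) vK.
  (* The Gramian must send [eta] to the displacement that the control has to produce on top of the
     free motion. *)
  move=> yb; pose eta := invmx (gramian al a b g A B) *m (yb - Psi al A g a b *m y0).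
  pose p i l x := response al a b g A B b i l x.
  (* The Gramian control (Phi B)^T [eta] with the weight attached, so that its response integrates
     to the Gramian times [eta]. *)
  pose u x : 'cV[R]_N := \col_l ((b - x) `^ (1 - al) * \sum_j p j l x * eta j 0).
  have [K K0 respK] := response_le al_gt0 al_lt1 a_lt_b g_cont A B.
  exists u.
    apply: (@bounded_control_function _ _ _ _ _ al_gt0 al_lt1 a_lt_b g_cont _ _ _ _ u
      (\sum_j K * `|eta j 0|)).
    - by rewrite sumr_ge0// => j _; rewrite mulr_ge0.
    - move=> l; under eq_fun do rewrite mxE; apply: measurable_funM.
        apply: (measurableT_comp (measurable_powR (1 - al))).
        exact: measurable_funB.
      apply: measurable_sum => j; apply: measurable_funM => //.
      exact: measurable_response.
    - move=> x l ax xb; rewrite mxE normrM (ger0_norm (powR_ge0 _ _)).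
      have /andP[w0 w1] := weight_abelk_le1 al xb.
      apply: (@le_trans _ _ ((b - x) `^ (1 - al) *
         \sum_j (K * abelk al (b - x)) * `|eta j 0|)).
        rewrite ler_wpM2l ?powR_ge0// (le_trans (ler_norm_sum _ _ _))//.
        by apply: ler_sum => j _; rewrite normrM ler_wpM2r// respK.
      rewrite mulr_sumr; apply: ler_sum => j _.
      rewrite (_ : _ * _ = (b - x) `^ (1 - al) * abelk al (b - x) *
        (K * `|eta j 0|)); last by ring.
      by rewrite ler_piMl// mulr_ge0.
  rewrite /solution; apply/colP => i; rewrite !mxE.
  have -> : \int[lebesgue_measure]_(x in `[a, b]) (Phi al A g x b *m B *m u x) i 0 =
      (gramian al a b g A B *m eta) i 0.
    rewrite gramian_mulE//; apply: eq_Rintegral => x.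
    rewrite inE/= in_itv/= => /andP[ax xb].
    rewrite mxE; transitivity (\sum_l \sum_j
        p i l x * ((b - x) `^ (1 - al) * (p j l x * eta j 0))).
      apply: eq_bigr => l _; rewrite (responseE al_gt0 al_lt1 a_lt_b g_cont)//.
      by rewrite mxE !mulr_sumr.
    rewrite exchange_big/=; apply: eq_bigr => j _.
    rewrite /gramian_density mulr_sumr mulr_suml; apply: eq_bigr => l _.
    by rewrite /p; ring.
  by rewrite /eta mulKVmx// !mxE addrC subrK.
apply/eqP; rewrite -/(row_free _) -kermx_eq0; apply/rowV0P => v /sub_kermxP vK.
have vAB := (kalman_matrix_eq0 A B v).1 vK.
(* The displacement is asked to be v^T itself. As v annihilates every displacement, the squared norm
   of v is 0. *)
have [u [_ intu] sol] := ctrl (Psi al A g a b *m y0 + v^T).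
have vv : (v *m v^T) 0 0 = 0.
  move: sol; rewrite /solution => /addrI <-; rewrite mxE.
  under eq_bigr do rewrite mxE.
  have intb i : (@lebesgue_measure R).-integrable `[a, b]
      (EFin \o (fun x => (Phi al A g x b *m B *m u x) i 0)).
    by apply: intu; rewrite in_itv/= lab lexx.
  under eq_bigr do rewrite -RintegralZl//.
  rewrite -Rintegral_sum//; last first.
    by move=> i; exact: (integrableZl _ (v 0 i) (intb i)).
  rewrite /Rintegral integral0_eq// => x /=; rewrite in_itv/= => /andP[ax xb].
  congr (_%:E); transitivity ((v *m Phi al A g x b *m B *m u x) 0 0).
    by rewrite -!mulmxA [RHS]mxE; apply: eq_bigr => i _; rewrite mulmxA.
  rewrite (_ : v *m _ *m _ = 0) ?mul0mx ?mxE//; apply/matrixP => i l.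
  rewrite (mulmx_PhiE al_gt0 al_lt1 a_lt_b g_cont)// mxE.
  under eq_fun do rewrite vAB mxE.
  by rewrite abel_series0 mulr0.
apply/rowP => i; rewrite mxE; apply/eqP; rewrite -sqrf_eq0; apply/eqP.
move: vv; rewrite mxE => /eqP; rewrite psumr_eq0; last first.
  by move=> j _; rewrite mxE -expr2 sqr_ge0.
by move=> /allP/(_ i (mem_index_enum _)); rewrite mxE -expr2 => /eqP.
Qed.
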